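(* If $\Gamma$ and $\Delta$ are non-empty sets and $1<q<\infty$, then the projective tensor products $c_0(\Gamma)\widehat{\otimes}_\pi c_0(\Delta)$ and $c_0(\Gamma)\widehat{\otimes}_\pi\ell_q(\Delta)$ are subspaces of Hilbert generated spaces.
   Context: All Banach spaces are real; an operator is a continuous linear map. A Banach space $X$ is Hilbert generated if there exist a Hilbert space $H$ and an operator from $H$ to $X$ with dense range. ''Subspace of a Hilbert generated space'' means isomorphic to a norm closed linear subspace of some Hilbert generated Banach space. *)

(* Defs.v *)
From HB Require Import structures.
From mathcomp Require Import all_boot all_order all_algebra.
From mathcomp Require Import all_classical all_reals all_analysis.
From mathcomp Require Import lra.

Set Implicit Arguments.
Unset Strict Implicit.
Unset Printing Implicit Defensive.

Import Order.TTheory GRing.Theory Num.Theory.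
Import numFieldNormedType.Exports.

Local Open Scope classical_set_scope.
Local Open Scope ring_scope.
Local Open Scope quotient_scope.

Record seminorm (R : realType) (V : lmodType R) := Seminorm {
  seminorm_fun :> V -> R ;
  seminormD : forall x y,
    seminorm_fun (x + y) <= seminorm_fun x + seminorm_fun y ;
  seminormZ : forall (a : R) x, seminorm_fun (a *: x) = `|a| * seminorm_fun x }.

Section seminorm_theory.
Variables (R : realType) (V : lmodType R) (p : seminorm V).

Lemma seminorm0 : p 0 = 0.
Proof. by rewrite -(scale0r 0) seminormZ normr0 mul0r. Qed.

Lemma seminormN x : p (- x) = p x.
Proof. by rewrite -scaleN1r seminormZ normrN normr1 mul1r. Qed.

Lemma seminormB x y : p (x - y) = p (y - x).
Proof. by rewrite -opprB seminormN. Qed.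

Lemma seminorm_ge0 x : 0 <= p x.
Proof.
have := seminormD p x (- x); rewrite subrr seminorm0 seminormN => h; lra.
Qed.

Lemma seminorm_dist x y : `|p x - p y| <= p (x - y).
Proof.
have h1 := seminormD p (x - y) y; have h2 := seminormD p (y - x) x.
rewrite !subrK seminormB in h1 h2.
by rewrite ler_norml; apply/andP; split; rewrite ?(seminormB x y); lra.
Qed.

End seminorm_theory.

(* Completion of a seminormed space (V, p): Cauchy sequences modulo those along
   which p tends to 0, normed by the limit of p. *)
Section completion.
Variables (R : realType) (V : lmodType R) (p : seminorm V).

Definition cauchy_seqs : {pred nat -> V} := [pred u : nat -> V |
  `[< forall e : R, 0 < e -> exists N, forall m n, (N <= m)%N -> (N <= n)%N ->
        p (u m - u n) < e >]].

Lemma cauchy_seqs_submod_closed : submod_closed cauchy_seqs.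
Proof.
split.
  by apply/asboolP => e e0; exists 0%N => m n _ _; rewrite subrr seminorm0.
move=> a u v /asboolP cu /asboolP cv; apply/asboolP => e e0.
have a0 : 0 < `|a| + 1 by rewrite ltr_wpDl.
have [|N hN] := cu (e / 2 / (`|a| + 1)); first by rewrite !divr_gt0.
have [|M hM] := cv (e / 2); first by rewrite divr_gt0.
exists (maxn N M) => m n; rewrite !geq_max => /andP[Nm Mm] /andP[Nn Mn].
have -> : (a *: u + v) m - (a *: u + v) n = a *: (u m - u n) + (v m - v n).
  by rewrite scalerBr opprD addrACA.
apply: (le_lt_trans (seminormD _ _ _)); rewrite seminormZ (splitr e) ltr_leD//.
  apply: (@le_lt_trans _ _ ((`|a| + 1) * p (u m - u n))).
    by rewrite ler_wpM2r ?seminorm_ge0// lerDl.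
  by rewrite -ltr_pdivlMl// mulrC hN.
exact/ltW/hM.
Qed.

HB.instance Definition _ :=
  GRing.isSubmodClosed.Build R (nat -> V) cauchy_seqs cauchy_seqs_submod_closed.

Record cauchy_seq := CauchySeq {
  cauchy_seq_val :> nat -> V ; _ : cauchy_seq_val \in cauchy_seqs }.

HB.instance Definition _ := [isSub for cauchy_seq_val].
HB.instance Definition _ := [Choice of cauchy_seq by <:].
HB.instance Definition _ := [SubChoice_isSubLmodule of cauchy_seq by <:].

Definition cauchy_norm (u : cauchy_seq) : R := limn (fun n => p (u n)).


Lemma cauchy_normP (u : cauchy_seq) : p (u n) @[n --> \oo] --> cauchy_norm u.
Proof.
apply/cauchy_cvgP/cauchy_exP => e e0.
case: u => u /= /asboolP /(_ _ e0)[N uN]; exists (p (u N)).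
exists N => // n /= Nn; rewrite -ball_normE /ball_ /=.
exact: le_lt_trans (seminorm_dist _ _ _) (uN _ _ _ _).
Qed.

Lemma cauchy_normD u v : cauchy_norm (u + v) <= cauchy_norm u + cauchy_norm v.
Proof.
have h : p (u n) + p (v n) @[n --> \oo] --> cauchy_norm u + cauchy_norm v.
  by apply: cvgD; exact: cauchy_normP.
apply: (ler_cvg_to (cauchy_normP (u := u + v)) h).
by apply: nearW => n; exact: seminormD.
Qed.

Lemma cauchy_normZ (a : R) u : cauchy_norm (a *: u) = `|a| * cauchy_norm u.
Proof.
apply/cvg_lim => //; under eq_fun do rewrite [X in p X]/= seminormZ.
exact: cvgMr (@cauchy_normP u).
Qed.

Definition cauchy_seminorm := Seminorm cauchy_normD cauchy_normZ.

Definition null_seqs : {pred cauchy_seq} := [pred u | cauchy_norm u == 0].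

Lemma null_seqs_zmod_closed : zmod_closed null_seqs.
Proof.
split; first by rewrite inE; exact/eqP/(seminorm0 cauchy_seminorm).
move=> u v; rewrite !inE => /eqP u0 /eqP v0.
have h := seminormD cauchy_seminorm u (- v).
rewrite seminormN /= u0 v0 addr0 in h.
by rewrite eq_le h; exact: (seminorm_ge0 cauchy_seminorm (u - v)).
Qed.

HB.instance Definition _ :=
  GRing.isZmodClosed.Build cauchy_seq null_seqs null_seqs_zmod_closed.

Definition completion : Type := Quotient.quot null_seqs.

HB.instance Definition _ := Choice.on completion.
HB.instance Definition _ := GRing.Zmodule.on completion.
HB.instance Definition _ := EqQuotient.on completion.
HB.instance Definition _ :=
  ZmodQuotient.copy completion (Quotient.quot null_seqs).

Definition limit_class (u : cauchy_seq) : completion := \pi_completion u.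

Lemma limit_class_surj (x : completion) : exists u, x = limit_class u.
Proof. by exists (repr x); rewrite /limit_class reprK. Qed.

Lemma limit_class_eqP (u v : cauchy_seq) :
  limit_class u = limit_class v <-> cauchy_norm (u - v) = 0.
Proof.
have h : (limit_class u == limit_class v) = (cauchy_norm (u - v) == 0).
  by rewrite /limit_class piE /Quotient.equiv inE.
by split=> uv; apply/eqP; [rewrite -h; apply/eqP|rewrite h; apply/eqP].
Qed.

Lemma limit_classK (u : cauchy_seq) :
  limit_class (repr (limit_class u)) = limit_class u.
Proof. by rewrite /limit_class reprK. Qed.

Lemma limit_classD (u v : cauchy_seq) :
  limit_class (u + v) = limit_class u + limit_class v.
Proof. exact: raddfD. Qed.

Lemma limit_class0 : limit_class 0 = 0.
Proof. exact: raddf0. Qed.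

Definition completion_scale (a : R) (x : completion) : completion :=
  limit_class (a *: repr x).

Lemma limit_classZ (a : R) (u : cauchy_seq) :
  completion_scale a (limit_class u) = limit_class (a *: u).
Proof.
apply/limit_class_eqP; rewrite -scalerBr cauchy_normZ.
by have /limit_class_eqP -> := limit_classK u; rewrite mulr0.
Qed.

Lemma completion_scaleA (a b : R) x :
  completion_scale a (completion_scale b x) = completion_scale (a * b) x.
Proof. by have [u ->] := limit_class_surj x; rewrite !limit_classZ scalerA. Qed.

Lemma completion_scale1 : left_id 1 completion_scale.
Proof.
by move=> x; have [u ->] := limit_class_surj x; rewrite limit_classZ scale1r.
Qed.

Lemma completion_scaleDr : right_distributive completion_scale +%R.
Proof.
move=> a x y; have [u ->] := limit_class_surj x.
have [v ->] := limit_class_surj y.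
by rewrite -limit_classD !limit_classZ scalerDr limit_classD.
Qed.

Lemma completion_scaleDl x : {morph completion_scale^~ x : a b / a + b}.
Proof.
move=> a b; have [u ->] := limit_class_surj x.
by rewrite /= !limit_classZ scalerDl limit_classD.
Qed.

HB.instance Definition _ := GRing.Zmodule_isLmodule.Build R completion
  completion_scaleA completion_scale1 completion_scaleDr completion_scaleDl.

Definition completion_norm (x : completion) : R := cauchy_norm (repr x).

Lemma completion_normE (u : cauchy_seq) :
  completion_norm (limit_class u) = cauchy_norm u.
Proof.
apply/eqP; rewrite -subr_eq0 -normr_le0.
apply: (le_trans (seminorm_dist cauchy_seminorm _ _)).
by have /limit_class_eqP /= -> := limit_classK u.
Qed.

Lemma completion_normD x y :
  completion_norm (x + y) <= completion_norm x + completion_norm y.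
Proof.
have [u ->] := limit_class_surj x; have [v ->] := limit_class_surj y.
by rewrite -limit_classD !completion_normE cauchy_normD.
Qed.

Lemma completion_normZ (a : R) x :
  completion_norm (a *: x) = `|a| * completion_norm x.
Proof.
have [u ->] := limit_class_surj x.
by rewrite [_ *: _]limit_classZ !completion_normE cauchy_normZ.
Qed.

Lemma completion_norm_eq0 x : completion_norm x = 0 -> x = 0.
Proof.
have [u ->] := limit_class_surj x; rewrite completion_normE => u0.
by rewrite -limit_class0; apply/limit_class_eqP; rewrite subr0.
Qed.

HB.instance Definition _ := Lmodule_isNormed.Build R completion
  completion_normD completion_normZ completion_norm_eq0.

Lemma cst_cauchy_subproof (v : V) : (fun _ : nat => v) \in cauchy_seqs.
Proof.
by apply/asboolP => e e0; exists 0%N => m n _ _; rewrite subrr seminorm0.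
Qed.

Definition to_completion (v : V) : completion :=
  limit_class (CauchySeq (cst_cauchy_subproof v)).

Lemma norm_limit_class (u : cauchy_seq) : `|limit_class u| = cauchy_norm u.
Proof. exact: completion_normE. Qed.

Lemma limit_classB (u v : cauchy_seq) :
  limit_class (u - v) = limit_class u - limit_class v.
Proof. exact: raddfB. Qed.

Lemma norm_to_completionB (v w : V) :
  `|to_completion v - to_completion w| = p (v - w).
Proof.
rewrite -limit_classB norm_limit_class.
apply/cvg_lim => //; apply: (@cvg_trans _ (p (v - w) @[_ --> \oo])) => //.
exact: cvg_cst.
Qed.

Lemma to_completion_cvg (u : cauchy_seq) :
  to_completion (u n) @[n --> \oo] --> limit_class u.
Proof.
apply/cvgrPdist_le => e e0.
have [/asboolP/(_ _ e0)[N uN]] : (u : nat -> V) \in cauchy_seqs.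
  exact: valP u.
exists N => // n /= Nn; rewrite -limit_classB norm_limit_class.
apply: limr_le.
  apply/cvg_ex.
  exists (cauchy_norm (u - CauchySeq (cst_cauchy_subproof (u n)))).
  exact: cauchy_normP.
by exists N => // m /= Nm; apply: ltW; exact: uN.
Qed.

Lemma completion_complete (F : set_system completion) :
  ProperFilter F -> cauchy F -> cvg F.
Proof.
move=> FF /cauchyP cF.
have approx (n : nat) : {v : V | F (ball (to_completion v) n.+1%:R^-1)}.
  apply: cid; have [|x Fx] := cF (n.+1%:R^-1 / 2); first by rewrite divr_gt0.
  have [u xu] := limit_class_surj x.
  have /cvgrPdist_lt/(_ (n.+1%:R^-1 / 2))[|N _ /(_ N (leqnn N)) uN] :=
    to_completion_cvg (u := u).
    by rewrite divr_gt0.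
  exists (u N); apply: filterS Fx => y; rewrite -ball_normE /ball_ /= xu => xy.
  rewrite [ltRHS](splitr n.+1%:R^-1).
  rewrite -(subrKA (limit_class u)) (le_lt_trans (ler_normD _ _))// ltrD//.
  by rewrite distrC.
pose v n := sval (approx n).
have Fv n : F (ball (to_completion (v n)) n.+1%:R^-1).
  exact: svalP (approx n).
have inv_small (e : R) : 0 < e ->
    exists N, forall n, (N <= n)%N -> n.+1%:R^-1 < e.
  move=> e0; exists (Num.truncn e^-1) => n Nn.
  rewrite invf_plt ?posrE//; apply: lt_le_trans (truncnS_gt _) _.
  by rewrite ler_nat.
have vC : v \in cauchy_seqs.
  apply/asboolP => e e0.
  have [|N hN] := inv_small (e / 2); first by rewrite divr_gt0.
  exists N => m n Nm Nn.
  have [y [/=]] := filter_ex (filterI (Fv m) (Fv n)).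
  rewrite -!ball_normE /ball_ /= => ym yn.
  rewrite -norm_to_completionB (splitr e) -(subrKA y).
  rewrite (le_lt_trans (ler_normD _ _))// ltrD//.
    exact: lt_trans ym (hN _ Nm).
  by rewrite distrC; exact: lt_trans yn (hN _ Nn).
apply/cvg_ex; exists (limit_class (CauchySeq vC)).
apply/cvgrPdist_lt => e e0.
have [|N hN] := inv_small (e / 2); first by rewrite divr_gt0.
have /cvgrPdist_lt/(_ (e / 2))[|M _ hM] :=
  to_completion_cvg (u := CauchySeq vC).
  by rewrite divr_gt0.
have h1 := hN _ (leq_maxl N M); have h2 := hM _ (leq_maxr N M).
apply: filterS (Fv (maxn N M)) => y; rewrite -ball_normE /ball_ /= => vy.
rewrite -(subrKA (to_completion (v (maxn N M)))) (splitr e).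
rewrite (le_lt_trans (ler_normD _ _))// ltrD//.
exact: lt_trans vy h1.
Qed.

HB.instance Definition _ :=
  Uniform_isComplete.Build completion completion_complete.

End completion.

Section projective_tensor_product.
Variables (R : realType) (X Y : normedModType R).

(* The algebraic tensor product is realised as the linear span of the
   evaluations B |-> B x y inside the algebraic dual of the space of bilinear
   forms on X * Y; these forms are not required to be continuous. *)
Definition elementary_tensor (x : X) (y : Y) :
  {bilinear X -> Y -> R | *%R & *%R} -> R := fun B => B x y.

Definition tensor_sum (s : seq (X * Y)) :
    {bilinear X -> Y -> R | *%R & *%R} -> R :=
  \sum_(z <- s) elementary_tensor z.1 z.2.

Definition alg_tensors : {pred {bilinear X -> Y -> R | *%R & *%R} -> R} :=
  [pred u : {bilinear X -> Y -> R | *%R & *%R} -> R |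
    `[< exists s : seq (X * Y), u = tensor_sum s >]].

Lemma tensor_sum_cat s t : tensor_sum (s ++ t) = tensor_sum s + tensor_sum t.
Proof. by rewrite /tensor_sum big_cat. Qed.

Lemma tensor_sumZ (a : R) s :
  tensor_sum [seq (a *: z.1, z.2) | z <- s] = a *: tensor_sum s.
Proof.
rewrite /tensor_sum big_map scaler_sumr; apply: eq_bigr => z _.
by apply/funext => B; rewrite /elementary_tensor/= linearZl_LR.
Qed.

Lemma alg_tensors_submod_closed : submod_closed alg_tensors.
Proof.
split; first by apply/asboolP; exists [::]; rewrite /tensor_sum big_nil.
move=> a u v /asboolP[s ->] /asboolP[t ->]; apply/asboolP.
exists ([seq (a *: z.1, z.2) | z <- s] ++ t).
by rewrite tensor_sum_cat tensor_sumZ.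
Qed.

HB.instance Definition _ :=
  GRing.isSubmodClosed.Build R _ alg_tensors alg_tensors_submod_closed.

Record alg_tensor := AlgTensor {
  alg_tensor_val :> {bilinear X -> Y -> R | *%R & *%R} -> R ;
  _ : alg_tensor_val \in alg_tensors }.

HB.instance Definition _ := [isSub for alg_tensor_val].
HB.instance Definition _ := [Choice of alg_tensor by <:].
HB.instance Definition _ := [SubChoice_isSubLmodule of alg_tensor by <:].

Definition projective_cost (s : seq (X * Y)) : R :=
  \sum_(z <- s) `|z.1| * `|z.2|.

Definition projective_norm (u : alg_tensor) : R :=
  inf [set projective_cost s |
         s in [set s : seq (X * Y) | \val u = tensor_sum s]].

Lemma projective_cost_ge0 s : 0 <= projective_cost s.
Proof. by apply: sumr_ge0 => z _; rewrite mulr_ge0. Qed.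

Lemma projective_cost_cat s t :
  projective_cost (s ++ t) = projective_cost s + projective_cost t.
Proof. by rewrite /projective_cost big_cat. Qed.

Lemma projective_costZ (a : R) s :
  projective_cost [seq (a *: z.1, z.2) | z <- s] = `|a| * projective_cost s.
Proof.
rewrite /projective_cost big_map mulr_sumr; apply: eq_bigr => z _ /=.
by rewrite normrZ mulrA.
Qed.

Lemma projective_norm_le (u : alg_tensor) s :
  \val u = tensor_sum s -> projective_norm u <= projective_cost s.
Proof.
move=> us; apply: ge_inf; last by exists s.
by exists 0 => _ [t _ <-]; exact: projective_cost_ge0.
Qed.

Lemma projective_norm_approx (u : alg_tensor) (e : R) : 0 < e ->
  exists2 s, \val u = tensor_sum s & projective_cost s < projective_norm u + e.
Proof.
move=> e0.
have [_ [s us <-] se] : exists2 c : R, [set projective_cost s |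
    s in [set s : seq (X * Y) | \val u = tensor_sum s]] c &
    c < projective_norm u + e.
  apply: inf_adherent => //; split.
    have /asboolP[s us] := valP u.
    by exists (projective_cost s), s.
  by exists 0 => _ [t _ <-]; exact: projective_cost_ge0.
by exists s.
Qed.

Lemma projective_normD u v :
  projective_norm (u + v) <= projective_norm u + projective_norm v.
Proof.
apply/ler_addgt0Pr => e e0.
have e2 : 0 < e / 2 by rewrite divr_gt0.
have [s us hs] := projective_norm_approx u e2.
have [t vt ht] := projective_norm_approx v e2.
apply: (@le_trans _ _ (projective_cost (s ++ t))).
  by apply: projective_norm_le; rewrite tensor_sum_cat -us -vt.
by rewrite projective_cost_cat; lra.
Qed.

Lemma projective_normZ_le (a : R) u :
  projective_norm (a *: u) <= `|a| * projective_norm u.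
Proof.
apply/ler_addgt0Pr => e e0.
have a0 : 0 < `|a| + 1 by rewrite ltr_wpDl.
have [|s us hs] := projective_norm_approx u (e := e / (`|a| + 1)).
  by rewrite divr_gt0.
apply: (@le_trans _ _ (`|a| * projective_cost s)).
  rewrite -projective_costZ; apply: projective_norm_le.
  by rewrite tensor_sumZ -us.
apply: (@le_trans _ _ (`|a| * (projective_norm u + e / (`|a| + 1)))).
  by rewrite ler_wpM2l// ltW.
rewrite mulrDr lerD2l mulrCA ger_pMr// ler_pdivrMr// mul1r lerDl//.
Qed.

Lemma projective_normZ (a : R) u :
  projective_norm (a *: u) = `|a| * projective_norm u.
Proof.
apply/eqP; rewrite eq_le projective_normZ_le/=.
have [->|a0] := eqVneq a 0.
  rewrite normr0 mul0r; apply: lb_le_inf.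
    have /asboolP[s us] := valP (0 *: u).
    by exists (projective_cost s), s.
  by move=> _ [s _ <-]; exact: projective_cost_ge0.
rewrite -ler_pdivlMl ?normr_gt0// -normfV.
by rewrite -{1}[u](scalerK a0) projective_normZ_le.
Qed.

(* This seminorm is in fact a norm; separation is not needed here, as the
   completion identifies vectors at distance 0. *)
Definition projective_seminorm : seminorm alg_tensor :=
  Seminorm projective_normD projective_normZ.

Definition projective_tensor := completion projective_seminorm.

HB.instance Definition _ := CompleteNormedModule.on projective_tensor.

End projective_tensor_product.

Section c0.
Variables (R : realType) (T : choiceType).

Definition c0_funs : {pred T -> R} := [pred f : T -> R |
  `[< forall e : R, 0 < e -> finite_set [set t | e <= `|f t|] >]].

Lemma c0_funs_submod_closed : submod_closed c0_funs.
Proof.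
split.
  apply/asboolP => e e0; rewrite (_ : [set _ | _] = set0)//.
  by apply/seteqP; split => // t /=; rewrite normr0 leNgt e0.
move=> a f g /asboolP cf /asboolP cg; apply/asboolP => e e0.
have a0 : 0 < `|a| + 1 by rewrite ltr_wpDl.
have ff : finite_set [set t | e / 2 / (`|a| + 1) <= `|f t|].
  by apply: cf; rewrite !divr_gt0.
have fg : finite_set [set t | e / 2 <= `|g t|] by apply: cg; rewrite divr_gt0.
apply: (@sub_finite_set _ _ ([set t | e / 2 / (`|a| + 1) <= `|f t|] `|`
    [set t | e / 2 <= `|g t|])); last by rewrite finite_setU.
move=> t /= et; apply: contrapT => /not_orP[/negP + /negP].
rewrite -!ltNge ltr_pdivlMr// => ft gt.
have := ler_normD (a *: f t) (g t); rewrite [`|_ *: _|]normrM => h.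
have {}h := le_trans et h.
have h2 : `|a| * `|f t| <= `|f t| * (`|a| + 1).
  by rewrite mulrC ler_wpM2l// lerDl.
lra.
Qed.

HB.instance Definition _ :=
  GRing.isSubmodClosed.Build R (T -> R) c0_funs c0_funs_submod_closed.

Record c0 := C0 { c0_val :> T -> R ; _ : c0_val \in c0_funs }.

HB.instance Definition _ := [isSub for c0_val].
HB.instance Definition _ := [Choice of c0 by <:].
HB.instance Definition _ := [SubChoice_isSubLmodule of c0 by <:].

Definition c0_norm (f : c0) : R := sup [set `|f t| | t in [set: T]].

Lemma c0_has_ubound (f : c0) : has_ubound [set `|f t| | t in [set: T]].
Proof.
have /asboolP/(_ 1 ltr01) ff : (f : T -> R) \in c0_funs by exact: valP f.
have [s ss] := (finite_seqP _).1 ff.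
exists (1 + \sum_(t <- s) `|f t|) => _ [t _ <-].
have [t1|t1] := leP 1 `|f t|; last first.
  by apply: ler_wpDr; [exact: sumr_ge0|exact: ltW].
have ts : t \in s by have : [set t | 1 <= `|f t|] t by []; rewrite ss.
by rewrite (big_rem t)//= addrCA lerDl addr_ge0//; exact: sumr_ge0.
Qed.

Lemma c0_norm_ub (f : c0) t : `|f t| <= c0_norm f.
Proof. by apply: (ub_le_sup (c0_has_ubound f)); exists t. Qed.

Lemma c0_norm_ge0 (f : c0) : 0 <= c0_norm f.
Proof.
have [[t _]|/nonemptyPn T0] := pselect ([set: T] !=set0).
  exact: le_trans (normr_ge0 _) (c0_norm_ub f t).
by rewrite /c0_norm T0 image_set0 sup0.
Qed.

Lemma c0_norm_le (f : c0) (c : R) :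
  0 <= c -> (forall t, `|f t| <= c) -> c0_norm f <= c.
Proof.
move=> c0 fc; have [[t _]|/nonemptyPn T0] := pselect ([set: T] !=set0).
  by apply: ge_sup; [exists `|f t|, t|move=> _ [u _ <-]].
by rewrite /c0_norm T0 image_set0 sup0.
Qed.

Lemma c0_normD f g : c0_norm (f + g) <= c0_norm f + c0_norm g.
Proof.
apply: c0_norm_le => [|t]; first by rewrite addr_ge0 ?c0_norm_ge0.
by rewrite (le_trans (ler_normD _ _))// lerD ?c0_norm_ub.
Qed.

Lemma c0_normZ (a : R) f : c0_norm (a *: f) = `|a| * c0_norm f.
Proof.
have le_norm b g : c0_norm (b *: g) <= `|b| * c0_norm g.
  apply: c0_norm_le => [|t]; first by rewrite mulr_ge0 ?c0_norm_ge0.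
  by rewrite [`|_|]normrM ler_wpM2l// c0_norm_ub.
apply/eqP; rewrite eq_le le_norm/=.
have [->|a0] := eqVneq a 0; first by rewrite normr0 mul0r c0_norm_ge0.
by rewrite -ler_pdivlMl ?normr_gt0// -normfV -{1}[f](scalerK a0) le_norm.
Qed.

Lemma c0_norm_eq0 f : c0_norm f = 0 -> f = 0.
Proof.
move=> f0; apply/val_inj/funext => t; apply/eqP; rewrite -normr_le0 -f0.
exact: c0_norm_ub.
Qed.

HB.instance Definition _ := Lmodule_isNormed.Build R c0
  c0_normD c0_normZ c0_norm_eq0.

End c0.
Arguments c0 : clear implicits.

Section ell.
Variables (R : realType) (q : R) (q1 : 1 <= q) (T : choiceType).

Let q0 : 0 < q. Proof. exact: lt_le_trans q1. Qed.

Definition power_sum (f : T -> R) : \bar R :=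
  \esum_(t in [set: T]) (`|f t| `^ q)%:E.

(* The proof argument 1 <= q makes the normed space structure inferable. *)
Definition ell_funs of 1 <= q : {pred T -> R} :=
  [pred f : T -> R | (power_sum f < +oo)%E].

Lemma power_sum_ge0 f : (0 <= power_sum f)%E.
Proof. by apply: esum_ge0 => t _; rewrite lee_fin powR_ge0. Qed.

Lemma le_power_sum f g : (forall t, `|f t| <= `|g t|) ->
  (power_sum f <= power_sum g)%E.
Proof.
move=> fg; apply: le_esum => t _; rewrite lee_fin.
by rewrite ge0_ler_powR ?nnegrE// ltW.
Qed.

Lemma esumZ_le (f : T -> R) (c : R) : 0 <= c -> (forall t, 0 <= f t) ->
  (\esum_(t in [set: T]) (c * f t)%:E <=
   c%:E * \esum_(t in [set: T]) (f t)%:E)%E.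
Proof.
move=> c0 f0; apply: ge_ereal_sup => _ [A [finA AT] <-].
under eq_fsbigr do rewrite EFinM.
rewrite -ge0_mule_fsumr//.
apply: lee_wpmul2l; first by rewrite lee_fin.
by apply: ereal_sup_ubound; exists A.
Qed.

Lemma power_sumZ_le (a : R) f :
  (power_sum (a *: f) <= (`|a| `^ q)%:E * power_sum f)%E.
Proof.
apply: le_trans (esumZ_le _ _); rewrite ?powR_ge0//.
by apply: le_esum => t _; rewrite lee_fin [`|_|]normrM powRM.
Qed.

Lemma power_sum_convex (s t : R) (f g : T -> R) :
  0 <= s -> 0 <= t -> s + t = 1 ->
  (power_sum (s *: f + t *: g)%R <= s%:E * power_sum f + t%:E * power_sum g)%E.
Proof.
move=> s0 t0 st1.
have s01 : (0 <= s <= 1) by rewrite s0/=; lra.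
apply: (@le_trans _ _
  (\esum_(u in [set: T]) ((s * `|f u| `^ q)%:E + (t * `|g u| `^ q)%:E))%E).
  apply: le_esum => u _; rewrite lee_fin.
  apply: (@le_trans _ _ ((s * `|f u| + t * `|g u|) `^ q)).
    apply: ge0_ler_powR; rewrite ?nnegrE ?addr_ge0 ?mulr_ge0 ?(ltW q0)//.
    apply: (le_trans (ler_normD _ _)).
    by rewrite [`|(s *: f) u|]normrM [`|(t *: g) u|]normrM
      (ger0_norm s0) (ger0_norm t0).
  have -> : t = 1 - s by lra.
  apply: (convex_powR q1 (Itv01 (andP s01).1 (andP s01).2)) => //=;
    by rewrite inE/= in_itv/= normr_ge0.
rewrite esumD; last 2 first.
- by move=> u _; rewrite lee_fin mulr_ge0 ?powR_ge0.
- by move=> u _; rewrite lee_fin mulr_ge0 ?powR_ge0.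
by rewrite leeD// esumZ_le// => u; rewrite powR_ge0.
Qed.

Lemma ell_funs_submod_closed : submod_closed (ell_funs q1).
Proof.
have ell_scale a f : f \in (ell_funs q1) -> a *: f \in (ell_funs q1).
  rewrite !inE => hf; apply: le_lt_trans (power_sumZ_le _ _) _.
  by rewrite lte_mul_pinfty// lee_fin powR_ge0.
split.
  rewrite -(scale0r (0 : T -> R)) inE; apply: le_lt_trans (power_sumZ_le _ _) _.
  by rewrite normr0 powR0 ?gt_eqF// mul0e ltry.
move=> a f g ef eg.
have -> : a *: f + g = 2 *: (2^-1 *: (a *: f) + 2^-1 *: g).
  by rewrite scalerDr !scalerA divff// !scale1r mul1r.
apply: (ell_scale); rewrite inE.
apply: le_lt_trans (power_sum_convex _ _ _ _ _) _ => //.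
  lra.
have := ell_scale a f ef; move: eg; rewrite !inE => eg ef'.
by apply: lte_add_pinfty; rewrite lte_mul_pinfty.
Qed.

HB.instance Definition _ :=
  GRing.isSubmodClosed.Build R (T -> R) (ell_funs q1) ell_funs_submod_closed.

Record ell := Ell { ell_val :> T -> R ; _ : ell_val \in (ell_funs q1) }.

HB.instance Definition _ := [isSub for ell_val].
HB.instance Definition _ := [Choice of ell by <:].
HB.instance Definition _ := [SubChoice_isSubLmodule of ell by <:].

Definition ell_norm (f : ell) : R := fine (power_sum f) `^ q^-1.

Lemma power_sum_fin (f : ell) : power_sum f = (fine (power_sum f))%:E.
Proof.
have hf : (f : T -> R) \in (ell_funs q1) by exact: valP f.
by rewrite fineK// ge0_fin_numE ?power_sum_ge0//; move: hf; rewrite inE.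
Qed.

Lemma ell_norm_ge0 f : 0 <= ell_norm f. Proof. exact: powR_ge0. Qed.

Lemma ell_norm_powR (f : ell) : (ell_norm f `^ q)%:E = power_sum f.
Proof.
rewrite /ell_norm -powRrM mulVf ?gt_eqF// powRr1 -?power_sum_fin//.
by rewrite fine_ge0 ?power_sum_ge0.
Qed.

Lemma ell_norm_le (f : ell) (c : R) :
  0 <= c -> (power_sum f <= (c `^ q)%:E)%E -> ell_norm f <= c.
Proof.
move=> c0; rewrite power_sum_fin lee_fin => fc.
have -> : c = (c `^ q) `^ q^-1 by rewrite -powRrM mulfV ?gt_eqF// powRr1.
apply: ge0_ler_powR; rewrite ?nnegrE ?powR_ge0 ?fine_ge0 ?power_sum_ge0//.
by rewrite invr_ge0 ltW.
Qed.

Lemma ell_norm_eq0 f : ell_norm f = 0 -> f = 0.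
Proof.
move=> f0; apply/val_inj/funext => t; apply/eqP.
have pf : power_sum f = 0%E.
  by rewrite -ell_norm_powR f0 powR0 ?gt_eqF.
have : ((`|f t| `^ q)%:E <= power_sum f)%E.
  apply: esum_ge; exists [set t]; first by split.
  by rewrite fsbig_set1.
rewrite pf lee_fin => h; apply/eqP/normr0_eq0/(@powR_eq0_eq0 _ _ q)/eqP.
by rewrite eq_le h powR_ge0.
Qed.

Lemma ell_normZ (a : R) f : ell_norm (a *: f) = `|a| * ell_norm f.
Proof.
have le_norm b g : ell_norm (b *: g) <= `|b| * ell_norm g.
  apply: ell_norm_le; first by rewrite mulr_ge0 ?ell_norm_ge0.
  by rewrite powRM ?ell_norm_ge0// EFinM ell_norm_powR power_sumZ_le.
apply/eqP; rewrite eq_le le_norm/=.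
have [->|a0] := eqVneq a 0; first by rewrite normr0 mul0r ell_norm_ge0.
by rewrite -ler_pdivlMl ?normr_gt0// -normfV -{1}[f](scalerK a0) le_norm.
Qed.

Lemma ell_normD f g : ell_norm (f + g) <= ell_norm f + ell_norm g.
Proof.
have [/ell_norm_eq0 ->|f0] := eqVneq (ell_norm f) 0.
  by rewrite add0r lerDr ell_norm_ge0.
have [/ell_norm_eq0 ->|g0] := eqVneq (ell_norm g) 0.
  by rewrite addr0 lerDl ell_norm_ge0.
have {}f0 : 0 < ell_norm f by rewrite lt_neqAle eq_sym f0 ell_norm_ge0.
have {}g0 : 0 < ell_norm g by rewrite lt_neqAle eq_sym g0 ell_norm_ge0.
have unit_ball h : 0 < ell_norm h -> power_sum ((ell_norm h)^-1 *: h) = 1%E.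
  move=> h0; rewrite -(ell_norm_powR ((ell_norm h)^-1 *: h)).
  by rewrite ell_normZ gtr0_norm ?invr_gt0// mulVf ?gt_eqF// powR1.
have {}unit_ball := (unit_ball f f0, unit_ball g g0).
move: (ell_norm f) (ell_norm g) f0 g0 unit_ball => a b a0 b0 unit_ball.
have ab0 : 0 < a + b := addr_gt0 a0 b0.
suff : ell_norm ((a + b)^-1 *: (f + g)) <= 1.
  rewrite ell_normZ gtr0_norm; last by rewrite invr_gt0.
  by rewrite ler_pdivrMl// mulr1.
have -> : (a + b)^-1 *: (f + g) =
    (a / (a + b)) *: (a^-1 *: f) + (b / (a + b)) *: (b^-1 *: g).
  rewrite !scalerA !(mulrAC _ (a + b)^-1) !divff ?gt_eqF// !mul1r.
  by rewrite scalerDr.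
apply: ell_norm_le => //.
apply: le_trans (power_sum_convex _ _ _ _ _) _.
- by rewrite divr_ge0 ?ltW.
- by rewrite divr_ge0 ?ltW.
- by rewrite -mulrDl divff ?gt_eqF.
rewrite !unit_ball// !mule1 -EFinD -mulrDl divff ?gt_eqF// powR1//.
Qed.

HB.instance Definition _ := Lmodule_isNormed.Build R ell
  ell_normD ell_normZ ell_norm_eq0.

End ell.
Arguments ell {R q} q1 T.

Section hilbert_generated.
Variable R : realType.

Definition is_hilbert (H : completeNormedModType R) : Prop :=
  exists ip : H -> H -> R,
    [/\ forall x y, ip x y = ip y x,
        forall (a : R) x y z, ip (a *: x + y) z = a * ip x z + ip y z &
        forall x, ip x x = `|x| ^+ 2].

Definition hilbert_generated (X : completeNormedModType R) : Prop :=
  exists H : completeNormedModType R, is_hilbert H /\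
    exists T : {linear H -> X}, continuous T /\ dense (range T).

(* The range of the linear map J is automatically a linear subspace of Y, and
   J is an isomorphism of X onto it: K is its inverse on range J. *)
Definition subspace_of_hilbert_generated (X : completeNormedModType R) : Prop :=
  exists2 Y : completeNormedModType R, hilbert_generated Y &
    exists (J : {linear X -> Y}) (K : Y -> X),
      [/\ closed (range J), continuous J, cancel J K &
          {within range J, continuous K}].

End hilbert_generated.

(* Main.v *)
Require Import Defs.
From HB Require Import structures.
From mathcomp Require Import all_boot all_order all_algebra.
From mathcomp Require Import all_classical all_reals all_analysis.
From mathcomp Require Import lra.

(* Let [e] be the unit vectors of c_0 and [d] those of c_0 or l_q. A norm-one
functional on the tensor product is a bilinear form with matrix
[b i j = B (e i) (d j)]. For [r > 0] the number of entries with [r < |b i j|]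
is bounded independently of [B]: each column is absolutely summable with sum at
most 1, and if [m] columns contain such an entry, then choosing signs on the
rows and the columns gives [r * m <= ||\sum_j +/- d j|| <= m ^ (1/q)] (or
[<= 1] for c_0), which bounds [m]. Cutting the entries off below [1/(n+1)] and
weighting the n-th cut suitably, one gets functions [psi_(s,n)] on the dual unit
ball with [\sum psi_(s,n)^2 <= 1] everywhere. Hence [l_2] maps continuously into
the uniform closure of their span, with dense range; by Hahn-Banach this
closure contains an isometric copy of the tensor product. *)

Set Implicit Arguments.
Unset Strict Implicit.
Unset Printing Implicit Defensive.

Import Order.TTheory GRing.Theory Num.Theory.
Import numFieldNormedType.Exports.

Local Open Scope classical_set_scope.
Local Open Scope ring_scope.

(** * Hahn-Banach through minimal sublinear functionals *)

Section hahn_banach.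
Variables (R : realType) (V : lmodType R).

(** Homogeneity is asked as an inequality only; applying it to [a^-1] gives equality for [0 < a]. *)
Definition sublinear (q : V -> R) :=
  (forall x y, q (x + y) <= q x + q y) /\
  (forall a x, 0 < a -> q (a *: x) <= a * q x).

Lemma sublinear0 q : sublinear q -> q 0 = 0.
Proof.
move=> [_ qZ]; have h1 := qZ 2 0 (ltr0Sn _ _); have h2 := qZ 2^-1 0.
rewrite !scaler0 in h1 h2; have {}h2 : q 0 <= 2^-1 * q 0 by apply: h2; lra.
by lra.
Qed.

Lemma sublinear_lb q x : sublinear q -> - q (- x) <= q x.
Proof.
move=> qS; have := qS.1 x (- x); rewrite subrr sublinear0//; lra.
Qed.

(* Dropping [q] in the direction [y]: a minimal sublinear functional must
   coincide with this smaller one, which forces additivity. *)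
Definition lower_along (q : V -> R) (y x : V) : R :=
  inf [set q (x + t *: y) - t * q y | t in [set t | 0 <= t]].

Lemma lower_along_le q y x t : sublinear q -> 0 <= t ->
  lower_along q y x <= q (x + t *: y) - t * q y.
Proof.
move=> qS t0; apply: ge_inf; last by exists t.
(* A lower bound for the infimum: [q (x + s *: y) + q (- x) >= q (s *: y) >= s * q y]. The last
   inequality is homogeneity at [s^-1], hence the separate case [s = 0]. *)
exists (- q (- x)) => _ [s /= s0 <-].
have [->|sn0] := eqVneq s 0.
  by rewrite scale0r addr0 mul0r subr0 sublinear_lb.
have := qS.1 (x + s *: y) (- x); rewrite addrAC subrr add0r => h1.
have := sublinear_lb (s *: y) qS; rewrite -scalerN => h2.
have sp : 0 < s by rewrite lt_neqAle eq_sym sn0.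
have h3 := sublinear_lb y qS.
have h4 := qS.2 s^-1 (s *: y); rewrite scalerA mulVf// scale1r in h4.
have {}h4 : q y <= s^-1 * q (s *: y) by apply: h4; rewrite invr_gt0.
rewrite ler_pdivlMl// in h4.
lra.
Qed.

Lemma lower_along_sublinear q y : sublinear q -> sublinear (lower_along q y).
Proof.
move=> qS.
have n0 x : [set q (x + t *: y) - t * q y | t in [set t | 0 <= t]] !=set0.
  by exists (q (x + 0 *: y) - 0 * q y), 0 => /=.
split=> [x z|a x a0].
  rewrite -lerBlDr; apply: lb_le_inf => // _ [t /= t0 <-].
  rewrite lerBlDr -lerBlDl; apply: lb_le_inf => // _ [s /= s0 <-].
  rewrite lerBlDl.
  apply: (le_trans (lower_along_le y (x + z) qS (addr_ge0 t0 s0))).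
  have := qS.1 (x + t *: y) (z + s *: y).
  by rewrite addrACA -scalerDl; lra.
rewrite -ler_pdivrMl//; apply: lb_le_inf => // _ [t /= t0 <-].
rewrite ler_pdivrMl//.
apply: (le_trans (lower_along_le y (a *: x) qS (mulr_ge0 (ltW a0) t0))).
by have := qS.2 a (x + t *: y) a0; rewrite scalerDr scalerA; lra.
Qed.

Lemma minimal_sublinear (p : V -> R) : sublinear p ->
  exists q, [/\ sublinear q, forall x, q x <= p x &
    forall r, sublinear r -> (forall x, r x <= q x) -> r = q].
Proof.
move=> pS; pose T := {q : V -> R | sublinear q /\ forall x, q x <= p x}.
(* The order is reversed, so that a maximal element in Zorn's lemma is a minimal functional. *)
pose le (s t : T) := `[< forall x, sval t x <= sval s x >].
have [||||q qmin] := @Zorn T le.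
- by move=> t; apply/asboolP.
- move=> r s t /asboolP rs /asboolP st; apply/asboolP => x.
  exact: le_trans (st x) (rs x).
- move=> [s sP] [t tP] /asboolP/= st /asboolP/= ts; apply: eq_exist => /=.
  by apply/funext => x; apply/eqP; rewrite eq_le ts st.
(* The bound of a chain is its pointwise infimum; [p x] is added so that the empty chain is covered.
   [Bsub] says that two values, even at different points, are dominated by those of a single
   functional. *)
- move=> A tA; pose B x := [set r | r = p x \/ exists2 s, A s & r = sval s x].
  have Bp x : B x (p x) by left.
  have Bn0 x : B x !=set0 by exists (p x).
  have Bsub x y r r' : B x r -> B y r' -> exists s : T, [/\ sval s x <= r,
      sval s y <= r' & forall z, B z (sval s z)].
    pose pT : T := exist _ p (conj pS (fun x => lexx (p x))).
    move=> [->|[s As ->]] [->|[s' As' ->]].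
    + by exists pT; split=> //= z; left.
    + exists s'; split => //=; first exact: (svalP s').2.
      by move=> z; right; exists s'.
    + exists s; split => //=; first exact: (svalP s).2.
      by move=> z; right; exists s.
    + have [/asboolP le_s|/asboolP le_s] := tA _ _ As As'.
        by exists s'; split=> // z; right; exists s'.
      by exists s; split=> // z; right; exists s.
  have Blb x : has_lbound (B x).
    exists (- p (- x)) => r Br.
    have [s [sr _ _]] := Bsub _ _ _ _ Br Br.
    apply: le_trans sr; apply: le_trans (sublinear_lb _ (svalP s).1).
    by rewrite lerN2 (svalP s).2.
  have BS : sublinear (fun x => inf (B x)).
    split=> [x y|a x a0].
      rewrite -lerBlDr; apply: lb_le_inf => // r Br.
      rewrite lerBlDr -lerBlDl; apply: lb_le_inf => // r' Br'.
      have [s [sr sr' Bs]] := Bsub _ _ _ _ Br Br'.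
      rewrite lerBlDl (le_trans (ge_inf (Blb _) (Bs _)))//.
      by rewrite (le_trans ((svalP s).1.1 _ _))// lerD.
    rewrite -ler_pdivrMl//; apply: lb_le_inf => // r Br.
    have [s [sr _ Bs]] := Bsub _ _ _ _ Br Br.
    rewrite ler_pdivrMl// (le_trans (ge_inf (Blb _) (Bs _)))//.
    by rewrite (le_trans ((svalP s).1.2 _ _ a0))// ler_pM2l.
  have Ble x : inf (B x) <= p x by exact: ge_inf.
  exists (exist _ (fun x => inf (B x)) (conj BS Ble) : T) => s As;
    apply/asboolP => x /=.
  by apply: ge_inf => //; right; exists s.
- case: q qmin => q [qS qp] qmin; exists q; split=> // r rS rq.
  have rp x : r x <= p x := le_trans (rq x) (qp x).
  have := qmin (exist _ r (conj rS rp)).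
  by move=> /(_ _)/(congr1 sval); apply; apply/asboolP.
Qed.

Lemma hahn_banach (p : V -> R) (x0 : V) : sublinear p ->
  exists f : V -> R, [/\ forall a x y, f (a *: x + y) = a * f x + f y,
    forall x, f x <= p x & f x0 = p x0].
Proof.
move=> pS.
(* Minimizing below [lower_along p x0] instead of [p] secures the value at [x0]: with [t = 1] it
   gives [q (- x0) <= p 0 - p x0 = - p x0]. *)
have [q [qS qp qmin]] := minimal_sublinear (lower_along_sublinear x0 pS).
have le_p x : lower_along p x0 x <= p x.
  by have := lower_along_le x0 x pS (lexx 0); rewrite scale0r addr0 mul0r subr0.
have {le_p}qp' x : q x <= p x by exact: le_trans (qp x) (le_p x).
have qD x y : q (x + y) = q x + q y.
  apply/eqP; rewrite eq_le qS.1/=.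
  have lq z : lower_along q y z <= q z.
    by have := lower_along_le y z qS (lexx 0);
      rewrite scale0r addr0 mul0r subr0.
  (* By minimality [lower_along q y = q], so [t = 1] yields [q x <= q (x + y) - q y], the converse
     of subadditivity. *)
  have := lower_along_le y x qS ler01.
  rewrite (qmin _ (lower_along_sublinear y qS) lq) scale1r mul1r; lra.
have q0 := sublinear0 qS.
have qN x : q (- x) = - q x by have := qD x (- x); rewrite subrr q0; lra.
have qZp a x : 0 < a -> q (a *: x) = a * q x.
  move=> a0; apply/eqP; rewrite eq_le qS.2//=.
  by have := qS.2 a (- x) a0; rewrite scalerN !qN mulrN lerN2.
have qZ a x : q (a *: x) = a * q x.
  have [a0|a0|->] := ltgtP a 0; last by rewrite scale0r mul0r.
    by apply: oppr_inj; rewrite -qN -scaleNr qZp ?mulNr// oppr_gt0.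
  exact: qZp.
exists q; split=> // [a x y|]; first by rewrite qD qZ.
apply/eqP; rewrite eq_le qp'/= -lerN2 -qN (le_trans (qp _))//.
have := lower_along_le x0 (- x0) pS ler01.
by rewrite scale1r addNr mul1r sublinear0// sub0r.
Qed.

End hahn_banach.

(** * Completions: Hilbert spaces, extension of contractions, isometric embeddings *)

Lemma to_completion_linear (R : realType) (V : lmodType R) (p : seminorm V) :
  linear (to_completion p).
Proof.
move=> a f g; rewrite [a *: to_completion _ _]limit_classZ -limit_classD.
by congr limit_class; exact/val_inj.
Qed.

Lemma norm_to_completion (R : realType) (V : lmodType R) (p : seminorm V) v :
  `|to_completion p v| = p v.
Proof. by rewrite norm_limit_class; apply/cvg_lim => //=; exact: cvg_cst. Qed.

Lemma linear_fun0 (R : realType) (V W : lmodType R) (f : V -> W) :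
  linear f -> f 0 = 0.
Proof.
by move=> /(_ (-1) 0 0); rewrite !scaleN1r oppr0 addr0 addNr.
Qed.

Lemma linear_funB (R : realType) (V W : lmodType R) (f : V -> W) x y :
  linear f -> f (x - y) = f x - f y.
Proof. by move=> /(_ (-1) y x); rewrite !scaleN1r !(addrC (- _)). Qed.

Section hilbert_completion.
Variables (R : realType) (V : lmodType R) (ip : V -> V -> R).
Hypothesis ipC : forall x y, ip x y = ip y x.
Hypothesis ip_linear : forall a x y z, ip (a *: x + y) z = a * ip x z + ip y z.
Hypothesis ip_ge0 : forall x, 0 <= ip x x.

Let ipDl x y z : ip (x + y) z = ip x z + ip y z.
Proof. by rewrite -{1}(scale1r x) ip_linear mul1r. Qed.

Let ip0l z : ip 0 z = 0.
Proof. by have := ipDl 0 0 z; rewrite addr0; lra. Qed.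

Let ipZl a x z : ip (a *: x) z = a * ip x z.
Proof. by rewrite -(addr0 (a *: x)) ip_linear ip0l addr0. Qed.

Let ipDr x y z : ip x (y + z) = ip x y + ip x z.
Proof. by rewrite ipC ipDl !(ipC _ x). Qed.

Let ipZr a x z : ip x (a *: z) = a * ip x z.
Proof. by rewrite ipC ipZl ipC. Qed.

Definition ip_norm (x : V) : R := Num.sqrt (ip x x).

Lemma ip_norm_sqr x : ip_norm x ^+ 2 = ip x x.
Proof. exact: sqr_sqrtr. Qed.

Lemma cauchy_schwarz x y : ip x y <= ip_norm x * ip_norm y.
Proof.
have expand (s t : R) :
    0 <= s ^+ 2 * ip x x - 2 * (s * t) * ip x y + t ^+ 2 * ip y y.
  have := ip_ge0 (s *: x + (- t) *: y).
  rewrite !(ipDl, ipDr, ipZl, ipZr) (ipC y x) !expr2; nra.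
have nx : 0 <= ip_norm x := sqrtr_ge0 _.
have ny : 0 <= ip_norm y := sqrtr_ge0 _.
rewrite -!ip_norm_sqr in expand.
(* The form is only semidefinite, so a null [x] may be nonzero. If [ip x y > 0], the scalar
   [s = (1 + ip_norm y ^+ 2) / ip x y] makes the expansion negative. *)
have [x0|x0] := eqVneq (ip_norm x) 0.
  rewrite x0 in expand *; rewrite leNgt mul0r; apply/negP => xy0.
  have := divfK (lt0r_neq0 xy0) (1 + ip_norm y ^+ 2).
  have := sqr_ge0 (ip_norm y).
  by have := expand ((1 + ip_norm y ^+ 2) / ip x y) 1; lra.
have [y0|y0] := eqVneq (ip_norm y) 0.
  rewrite y0 in expand *; rewrite leNgt mulr0; apply/negP => xy0.
  have := divfK (lt0r_neq0 xy0) (1 + ip_norm x ^+ 2).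
  have := sqr_ge0 (ip_norm x).
  by have := expand 1 ((1 + ip_norm x ^+ 2) / ip x y); lra.
have {}nx : 0 < ip_norm x by rewrite lt_neqAle eq_sym x0.
have {}ny : 0 < ip_norm y by rewrite lt_neqAle eq_sym y0.
have := expand (ip_norm y) (ip_norm x) => h.
rewrite -(ler_pM2l (mulr_gt0 nx ny)); move: h; rewrite !expr2; nra.
Qed.

Lemma ip_normD x y : ip_norm (x + y) <= ip_norm x + ip_norm y.
Proof.
rewrite -[leRHS]ger0_norm ?addr_ge0 ?sqrtr_ge0//.
rewrite -sqrtr_sqr ler_sqrt ?sqr_ge0// ipDl !ipDr (ipC y x) sqrrD !ip_norm_sqr.
by have := cauchy_schwarz x y; lra.
Qed.

Lemma ip_normZ a x : ip_norm (a *: x) = `|a| * ip_norm x.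
Proof.
by rewrite /ip_norm ipZl ipZr mulrA -expr2 sqrtrM ?sqr_ge0// sqrtr_sqr.
Qed.

Definition ip_seminorm := Seminorm ip_normD ip_normZ.

(** The inner product is defined from the norm by polarization. It is the limit of [ip (u n) (v n)]
    along representatives, and so inherits linearity. *)
Lemma completion_ip_hilbert : is_hilbert (completion ip_seminorm).
Proof.
pose H : completeNormedModType R := completion ip_seminorm.
pose ipH (x y : H) := (`|x + y| ^+ 2 - `|x - y| ^+ 2) / 4.
have ipHE (u v : cauchy_seq ip_seminorm) : ip (u n) (v n) @[n --> \oo] -->
    ipH (limit_class u) (limit_class v).
  have -> : (fun n => ip (u n) (v n)) = (fun n =>
      (ip_norm ((u + v : cauchy_seq ip_seminorm) n) ^+ 2
     - ip_norm ((u - v : cauchy_seq ip_seminorm) n) ^+ 2) / 4).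
    apply/funext => n; rewrite !ip_norm_sqr.
    have -> : (u - v : cauchy_seq ip_seminorm) n = u n + (-1) *: v n.
      by rewrite scaleN1r.
    have -> : (u + v : cauchy_seq ip_seminorm) n = u n + v n by [].
    rewrite !(ipDl, ipDr, ipZl, ipZr) (ipC (v n) (u n)); lra.
  rewrite /ipH -limit_classB -limit_classD !norm_limit_class.
  have cvg_sqr (w : cauchy_seq ip_seminorm) :
      ip_norm (w n) ^+ 2 @[n --> \oo] --> cauchy_norm w ^+ 2.
    rewrite expr2; under eq_fun do rewrite expr2.
    by apply: cvgM; exact: cauchy_normP.
  by apply: cvgMr_tmp; apply: cvgB; exact: cvg_sqr.
exists ipH; split.
- by move=> x y; rewrite /ipH (addrC x) distrC.
- move=> a x y z; have [u ->] := limit_class_surj x.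
  have [v ->] := limit_class_surj y; have [w ->] := limit_class_surj z.
  rewrite [a *: _]limit_classZ -limit_classD.
  apply: (cvg_unique _ (ipHE (a *: u + v) w)) => //.
  have -> : (fun n => ip ((a *: u + v : cauchy_seq ip_seminorm) n) (w n)) =
      (fun n => a * ip (u n) (w n) + ip (v n) (w n)).
    by apply/funext => n; rewrite -ip_linear.
  by apply: cvgD; [apply: cvgMl_tmp|]; exact: ipHE.
- move=> x; rewrite /ipH subrr normr0 expr0n/= subr0 -mulr2n -scaler_nat normrZ.
  by rewrite normr_nat exprMn; lra.
Qed.

End hilbert_completion.

Section completion_extension.
Variables (R : realType) (V : lmodType R) (p : seminorm V).
Variables (Y : completeNormedModType R) (L : V -> Y).
Hypothesis L_linear : forall a x y, L (a *: x + y) = a *: L x + L y.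
Hypothesis L_le : forall x, `|L x| <= p x.

Let L_sub x y : L (x - y) = L x - L y.
Proof.
by rewrite addrC -scaleN1r L_linear scaleN1r addrC.
Qed.

(** [L] sends Cauchy sequences to convergent ones. The limit depends only on the class, because its
    norm is at most [cauchy_norm] of the sequence. *)
Lemma completion_extension : exists T : {linear completion p -> Y},
  (forall x, `|T x| <= `|x|) /\ (forall v, T (to_completion p v) = L v).
Proof.
have cvgL (u : cauchy_seq p) : cvg (L (u n) @[n --> \oo]).
  apply/cauchy_cvgP/cauchy_exP => e e0.
  have /asboolP/(_ _ e0)[N uN] : (u : nat -> V) \in cauchy_seqs p.
    exact: valP u.
  exists (L (u N)), N => // n /= Nn.
  rewrite -ball_normE /ball_/= -L_sub (le_lt_trans (L_le _))// uN//.
pose T0 (x : completion p) := lim (L (repr x n) @[n --> \oo]).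
have norm_lim (u : cauchy_seq p) :
    `|lim (L (u n) @[n --> \oo])| <= cauchy_norm u.
  have /(_ _)/= h1 := cvg_norm (cvgL u).
  apply: (ler_cvg_to h1 (cauchy_normP (u := u))).
  exact: nearW.
have T0E (u : cauchy_seq p) : L (u n) @[n --> \oo] --> T0 (limit_class u).
  have E : T0 (limit_class u) = lim (L (u n) @[n --> \oo]).
    apply/eqP; rewrite -subr_eq0 -normr_le0.
    have := limit_classK u => /limit_class_eqP <-.
    rewrite /T0 -limB; [|exact: cvgL|exact: cvgL].
    apply: le_trans (norm_lim _).
    have -> : (fun n => L (repr (limit_class u) n)) - (fun n => L (u n)) =
        (fun n => L ((repr (limit_class u) - u : cauchy_seq p) n)).
      by apply/funext => n; rewrite L_sub.
    by [].
  by rewrite E; exact: cvgL.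
have T0_lin : linear T0.
  move=> a x y; have [u ->] := limit_class_surj x.
  have [v ->] := limit_class_surj y.
  rewrite [a *: limit_class u]limit_classZ -limit_classD.
  apply: (cvg_unique _ (T0E (a *: u + v))) => //.
  have -> : (fun n => L ((a *: u + v : cauchy_seq p) n)) =
      (fun n => a *: L (u n) + L (v n)).
    by apply/funext => n; rewrite -L_linear.
  by apply: cvgD; [apply: cvgZl_tmp|]; exact: T0E.
pose Tl := GRing.isLinear.Build R (completion p) Y *:%R T0 T0_lin.
pose T : {linear completion p -> Y} := HB.pack T0 Tl.
exists T; split=> [x|v].
  have [u ->] := limit_class_surj x; rewrite norm_limit_class.
  have <- : lim (L (u n) @[n --> \oo]) = T (limit_class u).
    exact/cvg_lim/T0E.
  exact: norm_lim.
have h := T0E (CauchySeq (cst_cauchy_subproof p v)).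
by apply: (cvg_unique _ h) => //=; exact: cvg_cst.
Qed.

End completion_extension.

Lemma contraction_continuous (R : realType) (X Y : normedModType R)
    (f : {linear X -> Y}) : (forall x, `|f x| <= `|x|) -> continuous f.
Proof.
move=> f1 x; apply/cvgrPdist_lt => e e0.
apply: filterS (nbhsx_ballx x e e0) => y; rewrite -ball_normE /ball_/= => xy.
by rewrite -linearB (le_lt_trans (f1 _)).
Qed.

Lemma isometry_subspace (R : realType) (X Y : completeNormedModType R)
    (J : {linear X -> Y}) : (forall x, `|J x| = `|x|) ->
  exists K : Y -> X, [/\ closed (range J), continuous J, cancel J K &
    {within range J, continuous K}].
Proof.
move=> J_iso.
have J_inj : injective J.
  move=> x y xy; apply/eqP;
    rewrite -subr_eq0 -normr_eq0 -J_iso linearB xy subrr.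
  by rewrite normr0.
(* [K] inverts [J] on its range and takes the default value 0 elsewhere. *)
pose K y := xget 0 [set x | J x = y].
have JK : cancel J K.
  move=> x; apply: J_inj; rewrite /K.
  by case: xgetP => [z _ -> |/(_ x) /(_ erefl)].
exists K; split=> //.
- move=> y cy.
  (* The filter generated by the preimages of the neighbourhoods of an adherent point [y]. It is
     Cauchy since [J] is isometric, and its limit is mapped to [y]. *)
  pose F := [set A : set X | exists2 B, nbhs y B & J @^-1` B `<=` A].
  have FF : ProperFilter F.
    split.
      by move=> [B yB]; have [_ [[x _ <-] Bx]] := cy _ yB; move/(_ x Bx).
    split; first by exists setT => //; exact: filterT.
      move=> A B [A' yA' A'A] [B' yB' B'B]; exists (A' `&` B');
        first exact: filterI.
      by move=> x [/A'A ? /B'B].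
    by move=> A B AB [A' yA' A'A]; exists A' => // x /A'A/AB.
  have [x xF] : exists x : X, nbhs x `<=` F.
    apply/cvg_ex/cauchy_cvgP/cauchy_exP => e e0.
    have [|_ [[x _ <-] yx]] := cy (ball y (e / 2));
      first exact/nbhsx_ballx/divr_gt0.
    exists x, (ball y (e / 2)); first exact/nbhsx_ballx/divr_gt0.
    move=> z /= yz; move: yx yz; rewrite -!ball_normE /ball_/= => yx yz.
    rewrite -J_iso linearB (splitr e) -(subrKA y).
    rewrite (le_lt_trans (ler_normD _ _))//.
    by rewrite ltrD// distrC.
  exists x => //; apply/eqP; rewrite -subr_eq0 -normr_le0;
    apply/ler_addgt0Pr => e e0; rewrite add0r.
  have [|B yB BA] := xF (ball x (e / 2)); first exact/nbhsx_ballx/divr_gt0.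
  have [|_ [[z _ <-] [Bz yz]]] := cy (B `&` ball y (e / 2)).
    by apply: filterI => //; exact/nbhsx_ballx/divr_gt0.
  have := BA z Bz; move: yz; rewrite -!ball_normE /ball_/= => yz xz.
  rewrite (splitr e) -(subrKA (J z)) (le_trans (ler_normD _ _))//
    -linearB J_iso.
  by rewrite lerD ?ltW// distrC.
- by apply: contraction_continuous => x; rewrite J_iso.
- apply/subspace_continuousP => _ [x _ <-]; rewrite /from_subspace JK.
  apply/cvgrPdist_lt => e e0.
  apply: filterS (nbhsx_ballx (J x) e e0) => y; rewrite -ball_normE /ball_/=.
  by move=> xy [z _ zy]; move: xy; rewrite -zy JK -linearB J_iso.
Qed.

(** * The uniform closure of a space of functions dominated by a seminorm *)

Section uniform_closure.
Variables (R : realType) (V : lmodType R) (p : seminorm V) (K : Type).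
Variable L : {linear V -> (K -> R)}.
Hypothesis L_le : forall v k, `|L v k| <= p v.

Definition uniform_limits : {pred K -> R} := [pred g : K -> R |
  `[< forall e : R, 0 < e -> exists v, forall k, `|g k - L v k| <= e >]].

Lemma uniform_limitsP (g : K -> R) : (g \in uniform_limits) <->
  (forall e : R, 0 < e -> exists v, forall k, `|g k - L v k| <= e).
Proof. by split=> [/asboolP|] // h; apply/asboolP. Qed.

Lemma uniform_limits_submod_closed : submod_closed uniform_limits.
Proof.
split.
  apply/uniform_limitsP => e e0; exists 0 => k.
  by rewrite linear0 subrr normr0 ltW.
move=> a f g /uniform_limitsP hf /uniform_limitsP hg.
apply/uniform_limitsP => e e0.
have a0 : 0 < `|a| + 1 by rewrite ltr_wpDl.
have [|v hv] := hf (e / 2 / (`|a| + 1)); first by rewrite !divr_gt0.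
have [|w hw] := hg (e / 2); first by rewrite divr_gt0.
exists (a *: v + w) => k; rewrite linearP.
have -> : (a *: f + g) k - (a *: L v + L w) k
    = a * (f k - L v k) + (g k - L w k).
  by rewrite mulrBr opprD addrACA.
rewrite (le_trans (ler_normD _ _))// (splitr e) lerD// normrM.
apply: (@le_trans _ _ ((`|a| + 1) * (e / 2 / (`|a| + 1)))).
  by apply: ler_pM => //; rewrite lerDl.
by rewrite mulrCA divff ?mulr1// gt_eqF.
Qed.

Lemma uniform_limits_closed (g : K -> R) :
  (forall e : R, 0 < e -> exists2 h, h \in uniform_limits &
    forall k, `|g k - h k| <= e) -> g \in uniform_limits.
Proof.
move=> gh; apply/uniform_limitsP => e e0.
have [|h /uniform_limitsP hL hg] := gh (e / 2); first by rewrite divr_gt0.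
have [|v hv] := hL (e / 2); first by rewrite divr_gt0.
exists v => k; rewrite (splitr e) -(subrKA (h k)) (le_trans (ler_normD _ _))//.
by rewrite lerD.
Qed.

HB.instance Definition _ :=
  GRing.isSubmodClosed.Build R (K -> R)
    uniform_limits uniform_limits_submod_closed.

Record unif := Unif { unif_val :> K -> R ; _ : unif_val \in uniform_limits }.

HB.instance Definition _ := [isSub for unif_val].
HB.instance Definition _ := [Choice of unif by <:].
HB.instance Definition _ := [SubChoice_isSubLmodule of unif by <:].

Definition sup_norm (g : unif) : R := sup [set `|g k| | k in [set: K]].

Lemma sup_norm_ub (g : unif) k : `|g k| <= sup_norm g.
Proof.
have [//|v hv] := (uniform_limitsP g).1 (valP g) 1.
apply: ub_le_sup; last by exists k.
exists (1 + p v) => _ [j _ <-].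
rewrite -(subrK (L v j) (g j)) (le_trans (ler_normD _ _))// lerD//; exact: hv.
Qed.

Lemma sup_norm_le (g : unif) (c : R) :
  0 <= c -> (forall k, `|g k| <= c) -> sup_norm g <= c.
Proof.
move=> c0 gc; have [[k _]|/nonemptyPn K0] := pselect ([set: K] !=set0).
  by apply: ge_sup; [exists `|g k|, k|move=> _ [j _ <-]].
by rewrite /sup_norm K0 image_set0 sup0.
Qed.

Lemma sup_norm_ge0 (g : unif) : 0 <= sup_norm g.
Proof.
have [[k _]|/nonemptyPn K0] := pselect ([set: K] !=set0).
  exact: le_trans (normr_ge0 _) (sup_norm_ub g k).
by rewrite /sup_norm K0 image_set0 sup0.
Qed.

Lemma sup_normD f g : sup_norm (f + g) <= sup_norm f + sup_norm g.
Proof.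
apply: sup_norm_le => [|k]; first by rewrite addr_ge0 ?sup_norm_ge0.
by rewrite (le_trans (ler_normD _ _))// lerD ?sup_norm_ub.
Qed.

Lemma sup_normZ (a : R) f : sup_norm (a *: f) = `|a| * sup_norm f.
Proof.
have le_norm b g : sup_norm (b *: g) <= `|b| * sup_norm g.
  apply: sup_norm_le => [|k]; first by rewrite mulr_ge0 ?sup_norm_ge0.
  by rewrite [`|_|]normrM ler_wpM2l// sup_norm_ub.
apply/eqP; rewrite eq_le le_norm/=.
have [->|a0] := eqVneq a 0; first by rewrite normr0 mul0r sup_norm_ge0.
by rewrite -ler_pdivlMl ?normr_gt0// -normfV -{1}[f](scalerK a0) le_norm.
Qed.

Definition sup_seminorm := Seminorm sup_normD sup_normZ.

Lemma linear_uniform_limits v : L v \in uniform_limits.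
Proof.
by apply/uniform_limitsP => e e0; exists v => k; rewrite subrr normr0 ltW.
Qed.

(** The generating operator extends [L] to the completion of [p]. Its range is dense because a point
    of the target is approximated by a uniform limit, and that one by some [L v]. *)
Lemma uniform_closure_hilbert_generated :
  is_hilbert (completion p) -> hilbert_generated (completion sup_seminorm).
Proof.
move=> pH; exists (completion p); split=> //.
pose D v : completion sup_seminorm :=
  to_completion sup_seminorm (Unif (linear_uniform_limits v)).
have D_sub g v : `|to_completion sup_seminorm g - D v|
    = sup_norm (g - Unif (linear_uniform_limits v)).
  exact: norm_to_completionB.
have [||T [T1 TD]] := @completion_extension _ _ p (completion sup_seminorm) D.
- move=> a x y; rewrite -to_completion_linear; congr to_completion.
  by apply/val_inj; rewrite /= linearP.
- move=> v; rewrite norm_to_completion.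
  by apply: sup_norm_le => [|k]; [exact: seminorm_ge0|exact: L_le].
exists T; split; first exact: contraction_continuous.
move=> O [x Ox] O_open.
have [e /= e0 xO] : exists2 e : R, 0 < e & ball x e `<=` O.
  by apply/nbhs_ballP; exact: open_nbhs_nbhs.
have [u xu] := limit_class_surj x.
have /cvgrPdist_lt/(_ (e / 2))[|n _ /(_ n (leqnn n)) xun] :=
  to_completion_cvg (u := u).
  by rewrite divr_gt0.
have [|v hv] := (uniform_limitsP (u n)).1 (valP (u n)) (e / 2).
  by rewrite divr_gt0.
exists (T (to_completion p v)); split; last by exists (to_completion p v).
apply: xO; rewrite -ball_normE /ball_/= TD (splitr e).
rewrite -(subrKA (to_completion sup_seminorm (u n))).
rewrite (le_lt_trans (ler_normD _ _))//.
rewrite ltr_leD// ?xu// D_sub sup_norm_le// ltW// divr_gt0//.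
Qed.

(** [ev x] is meant as evaluation at [x] on a set of functionals: contractive and norming together
    mean that [ev] is isometric for the sup norm. *)
Lemma uniform_closure_embedding (X : completeNormedModType R)
    (ev : X -> K -> R) :
    is_hilbert (completion p) ->
    (forall a x y, ev (a *: x + y) = a *: ev x + ev y) ->
    (forall x k, `|ev x k| <= `|x|) -> (forall x, exists k, ev x k = `|x|) ->
    (forall x, ev x \in uniform_limits) ->
  subspace_of_hilbert_generated X.
Proof.
move=> pH ev_linear ev_le ev_norming evL.
exists (completion sup_seminorm);
  first exact: uniform_closure_hilbert_generated.
pose J0 x : completion sup_seminorm :=
  to_completion sup_seminorm (Unif (evL x)).
have J0_lin : linear J0.
  move=> a x y; rewrite -to_completion_linear; congr to_completion.
  by apply/val_inj; exact: ev_linear.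
pose Jl := GRing.isLinear.Build R X (completion sup_seminorm) *:%R J0 J0_lin.
pose J : {linear X -> completion sup_seminorm} := HB.pack J0 Jl.
exists J; apply: isometry_subspace => x.
have -> : J x = to_completion sup_seminorm (Unif (evL x)) by [].
rewrite norm_to_completion; apply/eqP; rewrite eq_le sup_norm_le//=.
have [k kx] := ev_norming x.
by have := sup_norm_ub (Unif (evL x)) k; rewrite /= kx normr_id.
Qed.

End uniform_closure.

(** * Finitely supported functions as a dense part of l_2 *)

Section finite_support.
Variables (R : realType) (I : choiceType).

Definition fin_supp_funs : {pred I -> R} := [pred f : I -> R |
  `[< exists s : seq I, forall i, i \notin s -> f i = 0 >]].

Lemma fin_supp_funs_submod_closed : submod_closed fin_supp_funs.
Proof.
split; first by apply/asboolP; exists [::].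
move=> a f g /asboolP[s sf] /asboolP[t tg]; apply/asboolP; exists (s ++ t) => i.
rewrite mem_cat negb_or => /andP[si ti].
by rewrite [LHS]/= -[(a *: f + g) i]/(a * f i + g i) sf// tg// mulr0 addr0.
Qed.

HB.instance Definition _ := GRing.isSubmodClosed.Build R (I -> R)
  fin_supp_funs fin_supp_funs_submod_closed.

Record fin_supp := FinSupp {
  fin_supp_val :> I -> R ; _ : fin_supp_val \in fin_supp_funs }.

HB.instance Definition _ := [isSub for fin_supp_val].
HB.instance Definition _ := [Choice of fin_supp by <:].
HB.instance Definition _ := [SubChoice_isSubLmodule of fin_supp by <:].

Lemma fin_suppP (f : fin_supp) :
  exists2 s : seq I, uniq s & forall i, i \notin s -> f i = 0.
Proof.
have /asboolP[s sf] : (f : I -> R) \in fin_supp_funs by exact: valP f.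
by exists (undup s) => [|i]; rewrite ?undup_uniq// mem_undup => /sf.
Qed.

Definition pairing (w : I -> R) (f : fin_supp) : R :=
  \sum_(i \in [set: I]) f i * w i.

Lemma pairingE (w : I -> R) (f : fin_supp) (s : seq I) : uniq s ->
  (forall i, i \notin s -> f i = 0) -> pairing w f = \sum_(i <- s) f i * w i.
Proof.
move=> us sf; rewrite /pairing (fsbigE s)//.
  by apply: eq_bigl => i; rewrite in_setT.
by move=> i _ /sf ->; rewrite mul0r.
Qed.

Lemma pairing_linear w a f g :
  pairing w (a *: f + g) = a * pairing w f + pairing w g.
Proof.
have [s us sf] := fin_suppP f; have [t ut tg] := fin_suppP g.
have E (h : fin_supp) : (forall i, i \notin s ++ t -> h i = 0) ->
    pairing w h = \sum_(i <- undup (s ++ t)) h i * w i.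
  move=> hst; apply: pairingE (undup_uniq _) _ => i.
  by rewrite mem_undup => /hst.
have sf' i : i \notin s ++ t -> f i = 0.
  by rewrite mem_cat negb_or => /andP[/sf].
have tg' i : i \notin s ++ t -> g i = 0.
  by rewrite mem_cat negb_or => /andP[_ /tg].
rewrite !E//; last first.
  by move=> i st; rewrite -[LHS]/(a * f i + g i) sf'// tg'// mulr0 addr0.
rewrite mulr_sumr -big_split/=; apply: eq_bigr => i _.
by rewrite -[_ i]/(a * f i + g i) mulrDl mulrA.
Qed.

Definition l2_ip (f g : fin_supp) : R := pairing g f.

Lemma l2_ipC f g : l2_ip f g = l2_ip g f.
Proof. by apply: eq_fsbigr => i _; rewrite mulrC. Qed.

Lemma l2_ip_linear a f g h : l2_ip (a *: f + g) h = a * l2_ip f h + l2_ip g h.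
Proof. exact: pairing_linear. Qed.

Lemma l2_ip_ge0 f : 0 <= l2_ip f f.
Proof. by apply: fsumr_ge0 => i _; rewrite -expr2 sqr_ge0. Qed.

Definition l2_seminorm := ip_seminorm l2_ipC l2_ip_linear l2_ip_ge0.

Lemma pairing_le (w : I -> R) f :
  (forall s, uniq s -> \sum_(i <- s) w i ^+ 2 <= 1) ->
    `|pairing w f| <= l2_seminorm f.
Proof.
move=> w1.
suff le_pairing g : pairing w g <= l2_seminorm g.
  rewrite ler_norml lerNl le_pairing andbT -(seminormN l2_seminorm).
  apply: le_trans (le_pairing _).
  have := pairing_linear w (-1) f 0; rewrite scaleN1r addr0 => ->.
  by rewrite mulN1r lerDl; apply: fsumr_ge0 => i _; rewrite mul0r.
have [s us sg] := fin_suppP g.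
(* [w] may have infinite support, so it is truncated to the support of [g] before Cauchy-Schwarz is
   applied; the truncation has l_2 norm at most 1. *)
have wS : (fun i => if i \in s then w i else 0) \in fin_supp_funs.
  by apply/asboolP; exists s => i /negbTE ->.
rewrite (pairingE w us sg).
have -> : \sum_(i <- s) g i * w i = l2_ip g (FinSupp wS).
  rewrite [RHS](pairingE _ us sg); apply: eq_big_seq => i /= si.
  by rewrite si.
apply: (le_trans (cauchy_schwarz l2_ipC l2_ip_linear l2_ip_ge0 _ _)).
rewrite ler_piMr ?sqrtr_ge0// -sqrtr1 ler_sqrt// /l2_ip (pairingE _ us).
  apply: le_trans (w1 s us); rewrite le_eqVlt; apply/orP; left; apply/eqP.
  by apply: eq_big_seq => i /= si; rewrite si expr2.
by move=> i /= /negbTE ->.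
Qed.

End finite_support.

(* Linear density of [e], phrased so that it can be used as an induction
   principle over closed subspaces. *)
Definition total_family (R : realType) (X : normedModType R) (S : Type)
    (e : S -> X) :=
  forall P : X -> Prop, P 0 -> (forall a x y, P x -> P y -> P (a *: x + y)) ->
  (forall x, (forall d : R, 0 < d -> exists2 y, P y & `|x - y| <= d) -> P x) ->
  (forall s, P (e s)) -> forall x, P x.

(** * A criterion: total families with uniformly few large values on the dual ball *)

Section hilbert_generation_criterion.
Variables (R : realType) (X : completeNormedModType R) (S : choiceType).
Variable e : S -> X.
Hypothesis e_le1 : forall s, `|e s| <= 1.
Hypothesis e_total : total_family e.

Definition contractive_functional (f : X -> R) :=
  (forall a x y, f (a *: x + y) = a * f x + f y) /\ (forall x, `|f x| <= `|x|).

Hypothesis e_count : forall n : nat, exists N : nat,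
  forall f, contractive_functional f -> forall s : seq S, uniq s ->
  (forall x, x \in s -> n.+1%:R^-1 < `|f (e x)|) -> (size s <= N)%N.

Let K := {f : X -> R | contractive_functional f}.

Let N n := sval (cid (e_count n)).

(** At most [N n] values survive the n-th cut, each of modulus at most 1, so level [n] contributes
    at most [2^-1 ^+ n.+1] to the sum of squares; these bounds sum to 1. *)
Let weight n : R := 2^-1 ^+ n.+1 / (N n).+1%:R.

Let weight_gt0 n : 0 < weight n.
Proof. by rewrite divr_gt0// exprn_gt0// invr_gt0. Qed.

(* No continuity of the cut in [t] is needed: the dual ball carries no topology
   in this argument. *)
Let cut n (t : R) : R := if n.+1%:R^-1 < `|t| then t else 0.

Let cut_le n t : `|t - cut n t| <= n.+1%:R^-1.
Proof.
rewrite /cut; case: ltP => h; last by rewrite subr0.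
by rewrite subrr normr0 invr_ge0.
Qed.

Definition cut_fun (z : S * nat) (k : K) : R :=
  Num.sqrt (weight z.2) * cut z.2 (sval k (e z.1)).

Lemma cut_fun_sum (k : K) (s : seq (S * nat)) : uniq s ->
  \sum_(z <- s) cut_fun z k ^+ 2 <= 1.
Proof.
move=> us.
have partial m : \sum_(z <- s | (z.2 < m)%N) cut_fun z k ^+ 2 <= 1 - 2^-1 ^+ m.
  elim: m => [|m IH]; first by rewrite big_pred0// expr0 subrr.
  rewrite (bigID (fun z => (z.2 < m)%N))/=.
  rewrite (eq_bigl (fun z : S * nat => (z.2 < m)%N)); last first.
    by move=> z; rewrite andbC; case: ltnP => // zm; rewrite (leqW zm).
  apply: le_trans (lerD IH (_ : _ <= 2^-1 ^+ m.+1)) _; last first.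
    by rewrite exprS; set x := _ ^+ m; lra.
  rewrite (eq_bigl (fun z : S * nat => z.2 == m)); last first.
    by move=> z; rewrite -leqNgt ltnS andbC eqn_leq andbC.
  (* The indices of level [m] with a nonzero cut. They share their second coordinate, so their first
     coordinates are distinct and [e_count] bounds their number. *)
  pose t := [seq z <- s | (z.2 == m) && (m.+1%:R^-1 < `|sval k (e z.1)|)].
  apply: (@le_trans _ _ (weight m *+ size t)).
    rewrite size_filter -iter_addr_0 -big_const_seq big_mkcondr/=.
    apply: ler_sum => z /eqP zm; rewrite /cut_fun zm exprMn sqr_sqrtr;
      last exact: ltW.
    rewrite /cut; case: ifP => _; last by rewrite expr0n mulr0.
    rewrite -[leRHS]mulr1 ler_pM2l// -real_normK ?num_real// expr_le1//.
    exact: le_trans ((svalP k).2 _) (e_le1 _).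
  have : (size t <= N m)%N.
    rewrite -(size_map fst).
    apply: (svalP (cid (e_count m)) (sval k) (svalP k)).
      rewrite map_inj_in_uniq ?filter_uniq// => -[x i] [y j] /=.
      by rewrite !mem_filter/= =>
        /andP[/andP[/eqP-> _] _] /andP[/andP[/eqP-> _] _] ->.
    by move=> _ /mapP[z zt ->]; move: zt; rewrite mem_filter => /andP[/andP[]].
  move=> tN; apply: (@le_trans _ _ (weight m *+ (N m).+1)).
    by rewrite ler_wpMn2l ?ltW// leqW.
  by rewrite -[leLHS]mulr_natr /weight divfK.
(* The maximum exceeds every level in [s], so the partial sum up to it is the whole sum. *)
have sm : all (fun z => (z.2 < \max_(z <- s) z.2.+1)%N) s.
  apply/allP => z zs.
  exact: (@leq_bigmax_seq _ s xpredT (fun z => z.2.+1) z zs).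
have := partial (\max_(z <- s) z.2.+1)%N;
  rewrite -[leLHS]big_filter (all_filterP sm).
move=> /le_trans; apply; rewrite gerBl exprn_ge0//.
Qed.

Let L0 (v : fin_supp R (S * nat)%type) (k : K) : R := pairing (cut_fun^~ k) v.

Let L0_linear : linear L0.
Proof. by move=> a f g; apply/funext => k; exact: pairing_linear. Qed.

Let L : {linear fin_supp R (S * nat)%type -> (K -> R)} :=
  HB.pack L0 (GRing.isLinear.Build R _ _ *:%R L0 L0_linear).

Theorem hilbert_generation_criterion : subspace_of_hilbert_generated X.
Proof.
pose ev (x : X) (k : K) := sval k x.
have ev_linear a x y : ev (a *: x + y) = a *: ev x + ev y.
  by apply/funext => k; exact: (svalP k).1.
have L_le v k : `|L v k| <= l2_seminorm R (S * nat)%type v.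
  exact: pairing_le (cut_fun_sum k).
apply: (uniform_closure_embedding L_le (ev := ev)) => //.
- exact: completion_ip_hilbert.
- by move=> x k; exact: (svalP k).2.
- move=> x.
  have normS : sublinear (fun x : X => `|x|).
    by split=> [y z|a y a0]; rewrite ?ler_normD// normrZ gtr0_norm.
  have [f [f_lin f_le fx]] := hahn_banach x normS.
  have fN y : f (- y) = - f y.
    by have := f_lin (-1) y (- y); have := f_lin (-1) y 0;
      rewrite !scaleN1r; have := f_lin 1 0 0; rewrite scaler0 !addr0; lra.
  have fC : contractive_functional f.
    split=> // y; rewrite ler_norml lerNl -fN -{1}(normrN y) !f_le//.
  by exists (exist _ f fC).
have ev0 : ev 0 = 0 := linear_fun0 ev_linear.
have evB x y k : ev x k - ev y k = ev (x - y) k.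
  by rewrite addrC -mulN1r -(svalP k).1 scaleN1r addrC.
(* The vectors [x] with [ev x] in the uniform closure form a closed subspace, so only the [e s]
   remain. *)
apply: e_total => [|a x y Px Py|x xP|s].
- by rewrite ev0; exact: rpred0.
- by rewrite ev_linear rpredD// rpredZ.
- apply: uniform_limits_closed => d d0; have [y Py xy] := xP d d0.
  exists (ev y) => // k; apply: le_trans xy.
  by rewrite evB; exact: (svalP k).2.
- apply: uniform_limits_closed => d d0.
  have [n nd] : exists n : nat, n.+1%:R^-1 <= d.
    exists (Num.truncn d^-1); rewrite invf_ple ?posrE//.
    exact: ltW (truncnS_gt _).
  (* This multiple of a unit vector cancels the weight: [L] sends it to the n-th cut of [ev (e s)],
     which is within [n.+1%:R^-1 <= d] of [ev (e s)]. *)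
  have deltaS : (fun z => if z == (s, n) then (Num.sqrt (weight n))^-1 else 0)
      \in @fin_supp_funs R (S * nat)%type.
    by apply/asboolP; exists [:: (s, n)] => z; rewrite inE => /negbTE ->.
  exists (L (FinSupp deltaS)); first exact: linear_uniform_limits.
  move=> k; apply: le_trans nd.
  have -> : L (FinSupp deltaS) k = cut n (sval k (e s)).
    rewrite [LHS](pairingE _ (s := [:: (s, n)]))//.
      by rewrite big_seq1/= eqxx mulKf// gt_eqF// sqrtr_gt0.
    by move=> z /=; rewrite inE => /negbTE ->.
  exact: cut_le.
Qed.

End hilbert_generation_criterion.

(** * Regrouping sums along fibres and choosing signs *)

Lemma big_fiber (T : Type) (idx : T) (op : Monoid.com_law idx) (I : Type)
    (J : eqType) (g : I -> J) (r : seq I) (t : seq J) (F : I -> T) :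
  uniq t -> all (fun i => g i \in t) r ->
  \big[op/idx]_(j <- t) \big[op/idx]_(i <- r | g i == j) F i =
  \big[op/idx]_(i <- r) F i.
Proof.
move=> ut; elim: r => [_|i r IH /= /andP[it rt]].
  by rewrite big_nil big1// => j _; rewrite big_nil.
rewrite big_cons -(IH rt).
transitivity (\big[op/idx]_(j <- t)
    op (if j == g i then F i else idx) (\big[op/idx]_(i <- r | g i == j) F i)).
  apply: eq_bigr => j _; rewrite big_cons eq_sym; case: eqP => // _.
  by rewrite Monoid.mul1m.
by rewrite big_split/= -big_mkcond -big_filter filter_pred1_uniq// big_seq1.
Qed.

(* Signs are chosen one index at a time, each making the cross terms with the
   previous indices nonnegative. *)
Lemma signs_ge_diagonal (R : realType) (J : eqType) (c : J -> J -> R)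
    (t : seq J) :
  uniq t -> exists2 s : J -> R, forall j, `|s j| = 1 &
  \sum_(j <- t) c j j <= \sum_(i <- t) \sum_(j <- t) s i * s j * c i j.
Proof.
elim: t => [_|j0 t IH /= /andP[jt /IH[s s1 hs]]].
  by exists (fun=> 1) => [j|]; rewrite ?normr1// !big_nil.
pose cross := \sum_(j <- t) s j * (c j0 j + c j j0).
pose s0 : R := if 0 <= cross then 1 else -1.
have s0cross : 0 <= s0 * cross.
  by rewrite /s0; case: ifPn; rewrite ?mul1r// -ltNge mulN1r oppr_ge0 => /ltW.
have s0s0 : s0 * s0 = 1.
  by rewrite /s0; case: ifP; rewrite ?mulr1// mulrNN mulr1.
exists (fun j => if j == j0 then s0 else s j) => [j|].
  by case: eqP => // _; rewrite /s0; case: ifP; rewrite ?normrN normr1.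
have tE (F : J -> R -> R) : \sum_(j <- t) F j (if j == j0 then s0 else s j) =
    \sum_(j <- t) F j (s j).
  apply: eq_big_seq => j /= tj; case: eqP => // jj0.
  by rewrite -jj0 tj in jt.
rewrite !big_cons eqxx s0s0 mul1r -addrA lerD2l.
rewrite (tE (fun j x => s0 * x * c j0 j)).
rewrite (tE (fun i x =>
  \sum_(j <- j0 :: t) x * (if j == j0 then s0 else s j) * c i j)).
under [X in _ + X]eq_bigr => i _.
  rewrite big_cons eqxx (tE (fun j x => s i * x * c i j)).
  over.
rewrite big_split/= addrA; apply: (le_trans hs); rewrite lerDr.
apply: le_trans s0cross _; rewrite le_eqVlt; apply/orP; left; apply/eqP.
rewrite /cross mulr_sumr -big_split/=; apply: eq_bigr => j _.
by rewrite !mulrDr !mulrA (mulrC (s j) s0).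
Qed.

(** * Pure tensors and their totality *)

Section pure_tensor.
Variables (R : realType) (X Y : normedModType R).

Lemma elementary_tensor_alg (x : X) (y : Y) :
  elementary_tensor x y \in @alg_tensors R X Y.
Proof.
by apply/asboolP; exists [:: (x, y)]; rewrite /tensor_sum big_seq1.
Qed.

Definition pure_tensor (x : X) (y : Y) : projective_tensor X Y :=
  to_completion (projective_seminorm X Y)
    (AlgTensor (elementary_tensor_alg x y)).

Lemma pure_tensor_linearl y : linear (pure_tensor^~ y).
Proof.
move=> a x x'; rewrite -to_completion_linear; congr to_completion.
apply/val_inj/funext => B /=.
by rewrite /elementary_tensor linearDl linearZl_LR.
Qed.

Lemma pure_tensor_linearr x : linear (pure_tensor x).
Proof.
move=> a y y'; rewrite -to_completion_linear; congr to_completion.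
apply/val_inj/funext => B /=.
by rewrite /elementary_tensor linearDr linearZr_LR.
Qed.

Lemma pure_tensor_le x y : `|pure_tensor x y| <= `|x| * `|y|.
Proof.
rewrite norm_to_completion.
apply: le_trans (projective_norm_le (s := [:: (x, y)]) _) _.
  by rewrite /tensor_sum big_seq1.
by rewrite /projective_cost big_seq1.
Qed.

Lemma pure_tensor0l y : pure_tensor 0 y = 0.
Proof. exact: linear_fun0 (pure_tensor_linearl y). Qed.

Lemma pure_tensor0r x : pure_tensor x 0 = 0.
Proof. exact: linear_fun0 (pure_tensor_linearr x). Qed.

Lemma pure_tensorBl x x' y :
  pure_tensor (x - x') y = pure_tensor x y - pure_tensor x' y.
Proof. exact: (linear_funB _ _ (pure_tensor_linearl y)). Qed.

Lemma pure_tensorBr x y y' :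
  pure_tensor x (y - y') = pure_tensor x y - pure_tensor x y'.
Proof. exact: (linear_funB _ _ (pure_tensor_linearr x)). Qed.

(** Totality is applied in the first variable for arbitrary [y], then in the second with [x = e s];
    the norm bound on pure tensors transfers closedness. Finite sums and limits then reach every
    tensor. *)
Lemma pure_tensor_total (S T : Type) (e : S -> X) (d : T -> Y) :
  total_family e -> total_family d ->
  total_family (fun z : S * T => pure_tensor (e z.1) (d z.2)).
Proof.
move=> e_total d_total P P0 P_lin P_closed Pz.
have tensor_small (r : R) x y : 0 < r ->
    (`|x| <= r / (`|y| + 1) \/ `|y| <= r / (`|x| + 1)) ->
      `|pure_tensor x y| <= r.
  have small (a b : R) : 0 < r -> 0 <= b -> a <= r / (b + 1) -> a * b <= r.
    move=> r0 b0; rewrite ler_pdivlMr ?ltr_wpDl// mulrDr mulr1 => h.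
    have [a0|a0] := leP 0 a; first by lra.
    by apply: le_trans (ltW r0); rewrite mulr_le0_ge0// ltW.
  move=> r0 xy; apply: le_trans (pure_tensor_le x y) _.
  by case: xy => h; [|rewrite mulrC]; apply: small.
have Pxy x y : P (pure_tensor x y).
  move: x; apply: e_total => [|a x x' Px Px'|x hx|s].
  - by rewrite pure_tensor0l.
  - by rewrite pure_tensor_linearl; apply: P_lin.
  - apply: P_closed => r r0; have [|x' Px' xx'] := hx (r / (`|y| + 1)).
      by rewrite divr_gt0// ltr_wpDl.
    exists (pure_tensor x' y) => //; rewrite -pure_tensorBl.
    by apply: tensor_small => //; left.
  move: y; apply: d_total => [|a y y' Py Py'|y hy|t].
  - by rewrite pure_tensor0r.
  - by rewrite pure_tensor_linearr; apply: P_lin.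
  - apply: P_closed => r r0; have [|y' Py' yy'] := hy (r / (`|e s| + 1)).
      by rewrite divr_gt0// ltr_wpDl.
    exists (pure_tensor (e s) y') => //; rewrite -pure_tensorBr.
    by apply: tensor_small => //; right.
  - exact: (Pz (s, t)).
have Palg u : P (to_completion (projective_seminorm X Y) u).
  have /asboolP[s] := valP u.
  elim: s u => [|z s IH] u us.
    have -> : u = 0 by apply/val_inj; rewrite us /tensor_sum big_nil.
    by rewrite (linear_fun0 (to_completion_linear (projective_seminorm X Y))).
  have sS : tensor_sum s \in @alg_tensors R X Y by apply/asboolP; exists s.
  have -> : u = 1 *: AlgTensor (elementary_tensor_alg z.1 z.2) + AlgTensor sS.
    by apply/val_inj; rewrite us /tensor_sum big_cons/= scale1r.
  by rewrite to_completion_linear; apply: P_lin; [exact: Pxy|exact: IH].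
move=> x; have [u ->] := limit_class_surj x.
apply: P_closed => r r0.
have /cvgrPdist_le/(_ _ r0)[n _ /(_ n (leqnn n)) un] :=
  to_completion_cvg (u := u).
by exists (to_completion (projective_seminorm X Y) (u n)).
Qed.

End pure_tensor.

(** * Counting the large entries of the matrix of a functional *)

Section tensor_with_c0_like.
Variables (R : realType) (X Y : normedModType R) (S T : choiceType).
Variables (e : S -> X) (d : T -> Y).
Hypothesis e_total : total_family e.
Hypothesis d_total : total_family d.
Hypothesis e_signs : forall (a : S -> R) (s : seq S), uniq s ->
  (forall i, `|a i| <= 1) -> `|\sum_(i <- s) a i *: e i| <= 1.
Hypothesis d_le1 : forall j, `|d j| <= 1.
(** Sums of [m] vectors [d j] with coefficients in [-1, 1] have norm o(m), uniformly in the choice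
    of vectors and coefficients. *)
Hypothesis d_signs : forall r : R, 0 < r -> exists N : nat,
  forall (a : T -> R) (t : seq T), uniq t -> (forall j, `|a j| <= 1) ->
  r * (size t)%:R <= `|\sum_(j <- t) a j *: d j| -> (size t <= N)%N.

Let e_le1 i : `|e i| <= 1.
Proof.
have := @e_signs (fun=> 1) [:: i] isT; rewrite big_seq1 scale1r; apply => _.
by rewrite normr1.
Qed.

Section functional.
Variable f : projective_tensor X Y -> R.
Hypothesis f_contractive : contractive_functional f.

Let f_sum (I : Type) (r : seq I) (a : I -> R) (v : I -> projective_tensor X Y) :
  f (\sum_(i <- r) a i *: v i) = \sum_(i <- r) a i * f (v i).
Proof.
elim: r => [|i r IH]; last by rewrite !big_cons f_contractive.1 IH.
by rewrite !big_nil; apply/eqP;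
  rewrite -normr_le0 -(normr0 (projective_tensor X Y)) f_contractive.2.
Qed.

Let b i j := f (pure_tensor (e i) (d j)).

Lemma functional_sum (a : S -> R) (c : T -> R) (s : seq S) (t : seq T) :
  f (pure_tensor (\sum_(i <- s) a i *: e i) (\sum_(j <- t) c j *: d j)) =
  \sum_(i <- s) \sum_(j <- t) a i * c j * b i j.
Proof.
have E1 y : pure_tensor (\sum_(i <- s) a i *: e i) y
    = \sum_(i <- s) a i *: pure_tensor (e i) y.
  elim: s => [|i s IH]; first by rewrite !big_nil pure_tensor0l.
  by rewrite !big_cons pure_tensor_linearl IH.
have E2 x : pure_tensor x (\sum_(j <- t) c j *: d j)
    = \sum_(j <- t) c j *: pure_tensor x (d j).
  elim: t => [|j t IH]; first by rewrite !big_nil pure_tensor0r.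
  by rewrite !big_cons pure_tensor_linearr IH.
rewrite E1 f_sum; apply: eq_bigr => i _.
rewrite E2 f_sum mulr_sumr; apply: eq_bigr => j _.
by rewrite mulrA.
Qed.

Lemma functional_le x y : f (pure_tensor x y) <= `|x| * `|y|.
Proof.
by rewrite (le_trans (ler_norm _))// (le_trans (f_contractive.2 _))//
  pure_tensor_le.
Qed.

(** Testing [f] on the tensor of [\sum_(i <- s) Num.sg (b i j) *: e i] with [d j], of norm at most
    1, bounds the sum of the [|b i j|] by 1. *)
Lemma column_count (r : R) (j : T) (s : seq S) : 0 < r -> uniq s ->
  (forall i, i \in s -> r < `|b i j|) -> (size s <= Num.truncn r^-1)%N.
Proof.
move=> r0 us sb.
have h : r * (size s)%:R <= 1.
  (* [d j] is written as a one-term sum so that [functional_sum] applies. *)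
  have := functional_le (\sum_(i <- s) Num.sg (b i j) *: e i)
    (\sum_(j <- [:: j]) 1 *: d j).
  rewrite functional_sum => h1.
  have le1 : `|\sum_(i <- s) Num.sg (b i j) *: e i| *
      `|\sum_(j <- [:: j]) 1 *: d j| <= 1.
    rewrite big_seq1 scale1r mulr_ile1//.
    by apply: e_signs => // i; rewrite normr_sg; case: (_ != 0).
  apply: le_trans (le_trans h1 le1).
  rewrite mulr_natr -iter_addr_0 -(count_predT s) -big_const_seq/=.
  rewrite big_seq [leRHS]big_seq; apply: ler_sum => i si.
  by rewrite big_seq1 mulr1 -normrEsg ltW// sb.
rewrite Num.Theory.truncn_ge_nat; last by rewrite invr_ge0 ltW.
by rewrite -[r^-1]mul1r ler_pdivlMr// mulrC.
Qed.

(** [g] selects a large entry in each column, and columns may share a row. With signs [a i] on the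
    rows and [a (g j) * sgb j] on the columns, the double sum is a quadratic form in [a]; signs
    making it at least its diagonal exist, and the row combination has norm at most 1. *)
Lemma row_count (r : R) (g : T -> S) (t : seq T) : 0 < r -> uniq t ->
  (forall j, j \in t -> r < `|b (g j) j|) ->
  exists2 a : T -> R, forall j, `|a j| <= 1 &
    r * (size t)%:R <= `|\sum_(j <- t) a j *: d j|.
Proof.
move=> r0 ut tb; pose s := undup (map g t).
pose sgb j := Num.sg (b (g j) j).
(* Columns are grouped by selected row, so the diagonal of [c] adds up to the sum of all
   [|b (g j) j|]. *)
pose c i i' := \sum_(j <- t | g j == i') sgb j * b i j.
have gt : all (fun j => g j \in s) t.
  by apply/allP => j tj; rewrite mem_undup map_f.
have [a a1 ha] := signs_ge_diagonal c (undup_uniq (map g t)).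
exists (fun j => a (g j) * sgb j).
  by move=> j; rewrite normrM a1 mul1r normr_sg; case: (_ != 0).
have h := functional_le (\sum_(i <- s) a i *: e i)
  (\sum_(j <- t) (a (g j) * sgb j) *: d j).
have e1 : `|\sum_(i <- s) a i *: e i| <= 1.
  by apply: e_signs => [|i]; rewrite ?undup_uniq// a1.
have {}h := le_trans h (ler_wpM2r (normr_ge0 _) e1).
rewrite mul1r functional_sum in h.
apply: le_trans h; apply: le_trans (le_trans ha _).
  rewrite (eq_bigr (fun i =>
      \sum_(j <- t | g j == i) `|b (g j) j|)); last first.
    by move=> i _; apply: eq_bigr => j /eqP <-; rewrite -normrEsg.
  rewrite big_fiber ?undup_uniq//.
  rewrite mulr_natr -iter_addr_0 -(count_predT t) -big_const_seq/=.
  by rewrite big_seq [leRHS]big_seq; apply: ler_sum => j tj; rewrite ltW// tb.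
rewrite le_eqVlt; apply/orP; left; apply/eqP; apply: eq_bigr => i _.
rewrite -(big_fiber _ _ (undup_uniq (map g t)) gt); apply: eq_bigr => i' _.
rewrite /c mulr_sumr; apply: eq_bigr => j /eqP <-.
by rewrite !mulrA.
Qed.

End functional.

Theorem tensor_subspace_of_hilbert_generated :
  subspace_of_hilbert_generated (projective_tensor X Y).
Proof.
apply: (@hilbert_generation_criterion _ _ (S * T)%type
  (fun z => pure_tensor (e z.1) (d z.2))).
- by move=> z; rewrite (le_trans (pure_tensor_le _ _))// mulr_ile1.
- exact: pure_tensor_total.
move=> n; have r0 : 0 < n.+1%:R^-1 :> R by rewrite invr_gt0.
have [N hN] := d_signs r0.
(* Number of columns met times entries per column. The empty list is set aside so that [z0] can
   serve as default for [head]; for [j] in [t] that default is never reached. *)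
exists (N * Num.truncn (n.+1%:R^-1 : R)^-1)%N => f f1 [//|z0 s0].
set s := z0 :: s0 => us sb.
pose g j := (head z0 [seq z <- s | z.2 == j]).1.
pose t := undup (map snd s).
have st : all (fun z => z.2 \in t) s.
  by apply/allP => j tj; rewrite mem_undup map_f.
have gP j : j \in t -> (g j, j) \in s.
  rewrite mem_undup => /mapP[z zs ->].
  have : head z0 [seq z' <- s | z'.2 == z.2] \in [seq z' <- s | z'.2 == z.2].
    have : z \in [seq z' <- s | z'.2 == z.2] by rewrite mem_filter eqxx.
    by case: [seq _ <- _ | _] => //= x l _; rewrite mem_head.
  rewrite /g; move: (head _ _) => [x y].
  by rewrite mem_filter => /andP[/eqP/= ->].
have [|a a1 ha] := row_count f1 r0 (undup_uniq (map snd s)) (g := g).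
  by move=> j /gP/sb.
have tN := hN _ _ (undup_uniq _) a1 ha.
rewrite -sum1_size -(big_fiber _ _ (undup_uniq (map snd s)) st).
apply: (@leq_trans (\sum_(j <- t) Num.truncn (n.+1%:R^-1 : R)^-1)); last first.
  by rewrite big_const_seq count_predT iter_addn_0 mulnC leq_mul2r tN orbT.
apply: leq_sum => j _; rewrite sum1_count -size_filter -(size_map fst).
apply: (column_count f1 (j := j) r0).
  rewrite map_inj_in_uniq ?filter_uniq// => -[x i] [y k].
  by rewrite !mem_filter => /andP[/eqP/= -> _] /andP[/eqP/= -> _] ->.
move=> _ /mapP[z + ->]; rewrite mem_filter => /andP[/eqP <-].
exact: sb.
Qed.

End tensor_with_c0_like.

(** * Unit vectors of c_0 and l_q: totality and growth of their sums *)

Lemma sum_delta (R : pzRingType) (T : eqType) (a : T -> R) (s : seq T) (t : T) :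
  uniq s -> \sum_(i <- s) a i * (t == i)%:R = if t \in s then a t else 0.
Proof.
elim: s => [|i s IH] /=; first by rewrite big_nil.
move=> /andP[si us]; rewrite big_cons IH// in_cons.
have [->|_] := eqVneq t i; last by rewrite mulr0 add0r.
by rewrite (negbTE si) mulr1 addr0.
Qed.

Section c0_basis.
Variables (R : realType) (T : choiceType).

Lemma c0_delta_subproof (i : T) :
  (fun t : T => (t == i)%:R : R) \in @c0_funs R T.
Proof.
apply/asboolP => e e0; apply: (@sub_finite_set _ _ [set i]) => // t /=.
by case: eqVneq => // _; rewrite normr0 leNgt e0.
Qed.

Definition c0_delta (i : T) : c0 R T := C0 (c0_delta_subproof i).

Lemma c0_sum_deltaE (a : T -> R) (s : seq T) (t : T) : uniq s ->
  (\sum_(i <- s) a i *: c0_delta i) t = if t \in s then a t else 0.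
Proof.
move=> us; rewrite -(sum_delta a t us).
elim: s {us} => [|i s IH]; first by rewrite !big_nil.
by rewrite !big_cons -IH.
Qed.

Lemma c0_sum_delta_le1 (a : T -> R) (s : seq T) : uniq s ->
  (forall i, `|a i| <= 1) -> `|\sum_(i <- s) a i *: c0_delta i| <= 1.
Proof.
move=> us a1; apply: c0_norm_le => // t; rewrite c0_sum_deltaE//.
by case: ifP; rewrite ?normr0.
Qed.

(** Keeping the finitely many coordinates with [r <= |f t|] leaves a remainder of norm at most
    [r]. *)
Lemma c0_delta_total : total_family c0_delta.
Proof.
move=> P P0 P_lin P_closed Pd f; apply: P_closed => r r0.
have /asboolP/(_ _ r0)/finite_seqP[s fs] : (f : T -> R) \in @c0_funs R T.
  exact: valP f.
exists (\sum_(i <- undup s) f i *: c0_delta i).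
  by elim: (undup s) => [|i l IH]; rewrite ?big_nil// big_cons; exact: P_lin.
apply: c0_norm_le => [|t]; first exact: ltW.
have -> : (f - \sum_(i <- undup s) f i *: c0_delta i) t =
    f t - (\sum_(i <- undup s) f i *: c0_delta i) t by [].
rewrite c0_sum_deltaE ?undup_uniq// mem_undup; case: ifPn => ts.
  by rewrite subrr normr0 ltW.
rewrite subr0 leNgt; apply: contra ts => /ltW rt.
by have : [set t | r <= `|f t|] t by []; rewrite fs.
Qed.

End c0_basis.

Section ell_basis.
Variables (R : realType) (q : R) (q1 : 1 <= q) (T : choiceType).

Let q0 : 0 < q. Proof. exact: lt_le_trans q1. Qed.

Lemma power_sum_seq (g : T -> R) (s : seq T) : uniq s ->
  (forall t, `|g t| <= if t \in s then 1 else 0) ->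
    (power_sum q g <= (size s)%:R%:E)%E.
Proof.
move=> us gs; apply: (@le_trans _ _ (\esum_(t in [set` s]) 1%:E)%E).
  rewrite [leRHS]esum_mkcond; apply: le_esum => t _; rewrite mem_setE.
  case: ifPn (gs t) => ts.
    move=> g1; have -> : 1 = 1 `^ q :> R by rewrite powR1.
    by rewrite lee_fin ge0_ler_powR ?nnegrE ?(ltW q0).
  by rewrite normr_le0 => /eqP ->; rewrite normr0 powR0// gt_eqF.
rewrite esum_fset// -?fsbig_seq//.
by rewrite sumEFin lee_fin big_const_seq count_predT iter_addr_0.
Qed.

Lemma ell_delta_subproof (i : T) :
  (fun t : T => (t == i)%:R : R) \in @ell_funs R q T q1.
Proof.
rewrite inE; apply: le_lt_trans (power_sum_seq (s := [:: i]) _ _) _ => //.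
- by move=> t; rewrite inE; case: eqP => _; rewrite ?normr0 ?normr1.
- exact: ltry.
Qed.

Definition ell_delta (i : T) : ell q1 T := Ell (ell_delta_subproof i).

Lemma ell_sum_deltaE (a : T -> R) (s : seq T) (t : T) : uniq s ->
  (\sum_(i <- s) a i *: ell_delta i) t = if t \in s then a t else 0.
Proof.
move=> us; rewrite -(sum_delta a t us).
elim: s {us} => [|i s IH]; first by rewrite !big_nil.
by rewrite !big_cons -IH.
Qed.

Lemma ell_sum_delta_le (a : T -> R) (s : seq T) : uniq s ->
  (forall i, `|a i| <= 1) ->
  `|\sum_(i <- s) a i *: ell_delta i| <= (size s)%:R `^ q^-1.
Proof.
move=> us a1; apply: ell_norm_le; first exact: powR_ge0.
rewrite -powRrM mulVf ?gt_eqF// powRr1//.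
apply: power_sum_seq => // t; rewrite ell_sum_deltaE//.
by case: ifP; rewrite ?normr0.
Qed.

Lemma ell_delta_total : total_family ell_delta.
Proof.
move=> P P0 P_lin P_closed Pd f; apply: P_closed => r r0.
have rq : 0 < r `^ q by rewrite powR_gt0.
have pf : power_sum q f \is a fin_num by rewrite power_sum_fin.
(* A finite set whose partial sum is within [r]^ q[of the whole; the truncation error is then the
   tail over its complement, below]r [^ q]. *)
have [_ [A [/finite_seqP[s ->] _] <-] sA] := ub_ereal_sup_adherent rq pf.
exists (\sum_(i <- undup s) f i *: ell_delta i).
  by elim: (undup s) => [|i l IH]; rewrite ?big_nil// big_cons; exact: P_lin.
apply: ell_norm_le => //; first exact: ltW.
set B := [set` s] in sA.
apply: (@le_trans _ _ (\esum_(t in ~` B) (`|f t| `^ q)%:E)%E).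
  rewrite [leRHS]esum_mkcond; apply: le_esum => t _.
  have -> : (f - \sum_(i <- undup s) f i *: ell_delta i) t =
    f t - (\sum_(i <- undup s) f i *: ell_delta i) t by [].
  rewrite ell_sum_deltaE ?undup_uniq// mem_undup in_setC mem_setE.
  by case: ifP => _; rewrite ?subr0// subrr normr0 powR0// gt_eqF.
have term_ge0 t : (0 <= (`|f t| `^ q)%:E)%E by rewrite lee_fin powR_ge0.
have split_sum : power_sum q f = (\sum_(t \in B) (`|f t| `^ q)%:E
    + \esum_(t in ~` B) (`|f t| `^ q)%:E)%E.
  by rewrite /power_sum (esumID B)// !setTI (esum_fset (F := B))//;
    exact: finite_seq.
have c0 : (0 <= \esum_(t in ~` B) (`|f t| `^ q)%:E)%E.
  by apply: esum_ge0 => t _; exact: term_ge0.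
move: sA pf c0 split_sum; rewrite -[ereal_sup _]/(power_sum q f).
move: (power_sum q f) (\esum_(t in ~` B) _)%E (\sum_(t \in B) _)%E.
move=> [x| |] [y| |] [z| |]//=; rewrite ?lte_fin ?lee_fin => sA _ _ [] xzy;
  by lra.
Qed.

End ell_basis.

(** Dividing by [n%:R]^ q^-1[leaves]r * n%:R [^ (1 - q^-1) <= 1], whose exponent is positive exactly
    because [1 < q]; the case [n = 0] is split off for the division. *)
Lemma mul_le_powR_bound (R : realType) (q r : R) (n : nat) : 1 < q -> 0 < r ->
  r * n%:R <= n%:R `^ q^-1 -> (n <= Num.truncn (r^-1 `^ (1 - q^-1)^-1))%N.
Proof.
move=> q1 r0; case: n => // n h.
have q0 : 0 < q by lra.
have p0 : 0 < 1 - q^-1 by rewrite subr_gt0 invf_lt1.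
rewrite Num.Theory.truncn_ge_nat ?powR_ge0//.
have -> : n.+1%:R = (n.+1%:R `^ (1 - q^-1)) `^ (1 - q^-1)^-1 :> R.
  by rewrite -powRrM mulfV ?gt_eqF// powRr1.
rewrite ge0_ler_powR ?nnegrE ?powR_ge0 ?invr_ge0 ?(ltW p0) ?(ltW r0)//.
rewrite -[r^-1]mul1r ler_pdivlMr//
  -(ler_pM2r (powR_gt0 q^-1 (ltr0Sn R n))) mul1r.
apply: le_trans h; rewrite mulrAC -powRD ?subrK ?powRr1//; last first.
  by apply/implyP => _; rewrite pnatr_eq0.
by rewrite mulrC.
Qed.

(** * Application to the two tensor products *)

Theorem corollary6p6 (R : realType) (Gamma Delta : choiceType)
    (Gamma_neq0 : [set: Gamma] !=set0) (Delta_neq0 : [set: Delta] !=set0)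
    (q : R) (q_gt1 : 1 < q) :
  subspace_of_hilbert_generated
    (projective_tensor (c0 R Gamma) (c0 R Delta)) /\
  subspace_of_hilbert_generated
    (projective_tensor (c0 R Gamma) (ell (ltW q_gt1) Delta)).
Proof.
split.
- apply: (tensor_subspace_of_hilbert_generated
    (@c0_delta_total _ _) (@c0_delta_total _ _)).
  + exact: c0_sum_delta_le1.
  + move=> j; have := @c0_sum_delta_le1 R Delta (fun=> 1) [:: j] isT.
    by rewrite big_seq1 scale1r; apply => _; rewrite normr1.
  (* In c_0 these sums have norm at most 1, so [r * (size t)%:R <= 1]. *)
  + move=> r r0; exists (Num.truncn r^-1) => a t ut a1 rt.
    rewrite Num.Theory.truncn_ge_nat; last by rewrite invr_ge0 ltW.
    rewrite -[r^-1]mul1r ler_pdivlMr// mulrC (le_trans rt)//.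
    exact: c0_sum_delta_le1.
- apply: (tensor_subspace_of_hilbert_generated
    (@c0_delta_total _ _) (@ell_delta_total _ _ _ _)).
  + exact: c0_sum_delta_le1.
  + move=> j.
    have := @ell_sum_delta_le R q (ltW q_gt1) Delta (fun=> 1) [:: j] isT.
    by rewrite big_seq1 scale1r powR1; apply => _; rewrite normr1.
  + move=> r r0; exists (Num.truncn (r^-1 `^ (1 - q^-1)^-1)) => a t ut a1 rt.
    apply: (mul_le_powR_bound q_gt1 r0); apply: le_trans rt _.
    exact: ell_sum_delta_le.
Qed.
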